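(* Let $q$ be a prime power, $n\ge1$, $k\ge1$ and $g\ge 0$ integers, and for $i=1,\dots,k$ let $L_i=\mathrm{GL}_{n_{i,0}}\times\cdots\times\mathrm{GL}_{n_{i,s_i}}\subseteq\mathrm{GL}_n$ be a block diagonal (split) Levi subgroup, with $n_{i,0}+\cdots+n_{i,s_i}=n$. Let $\gamma_i=(\gamma_{i,0},\dots,\gamma_{i,s_i})\in \mathrm{Hom}(\mathbb{F}_q^*,\mathbb{C}^* )^{s_i+1}$, regarded as the linear character $(M_0,\dots,M_{s_i})\mapsto\prod_{j}\gamma_{i,j}(\det M_j)$ of $L_i(\mathbb{F}_q)$. Let $Q=(I,\Omega)$ be the associated star-shaped quiver with $g$ loops at the central vertex and $\alpha\in\mathbb{N}^I$ the associated dimension vector. Let $\Lambda$ be the character of the permutation representation of $\mathrm{GL}_n(\mathbb{F}_q)$ given by its conjugation action on $\mathfrak{gl}_n(\mathbb{F}_q)^g$. Let $V\subseteq(\mathbb{N}^I)^*$ and suppose that $\mathcal{X}=(R^G_{L_1}(\gamma_1),\dots,R^G_{L_k}(\gamma_k))$ is of level $V$. Then $$\Big\langle\Lambda\otimes\bigotimes_{i=1}^kR^G_{L_i}(\gamma_i),1\Big\rangle=M_{Q,\alpha,V}(q).$$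
   Context: $R^G_{L}(\gamma)$ denotes the Harish-Chandra induced character of $\mathrm{GL}_n(\mathbb{F}_q)$: inflate the linear character $\gamma$ of $L(\mathbb{F}_q)$ to $P(\mathbb{F}_q)$, where $P$ is the parabolic subgroup containing $L$ and the upper triangular matrices, via $P\to L$, and induce to $\mathrm{GL}_n(\mathbb{F}_q)$. It is not assumed irreducible. For characters $\chi,\psi$ of a finite group $H$, $\langle\chi,\psi\rangle=\frac1{|H|}\sum_{h\in H}\chi(h)\overline{\psi(h)}$. Star-shaped quiver $Q=(I,\Omega)$: vertices $0$ and $[i,j]$ for $1\le i\le k$, $1\le j\le s_i$; arrows $[i,1]\to 0$, $[i,j+1]\to[i,j]$, and $g$ loops at $0$. (Write $[i,0]=0$.) The dimension vector is $\alpha_0=n$, $\alpha_{[i,j]}=n-\sum_{h=0}^{j-1}n_{i,h}=\sum_{h=j}^{s_i}n_{i,h}$. $(\mathbb{N}^I)^*\subseteq\mathbb{N}^I$ is the set of vectors $\beta$ non-increasing along the legs: $\beta_{[i,j]}\ge\beta_{[i,j+1]}$ for all $i$ and $j\ge0$. Vectors are ordered componentwise. Level of a $k$-tuple: define $\sigma_{\mathcal{X}}\in\mathrm{Hom}(\mathbb{F}_q^*,\mathbb{C}^* )^I$ by $(\sigma_{\mathcal X})_0=\prod_{i=1}^k\gamma_{i,0}$ and $(\sigma_{\mathcal X})_{[i,j]}=\gamma_{i,j}\gamma_{i,j-1}^{-1}$ for $j\ge1$. For $\beta\in\mathbb{N}^I$ put $\sigma_{\mathcal X}^\beta=\prod_{v\in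 I}(\sigma_{\mathcal X})_v^{\beta_v}$. Let $\mathcal{H}^*_{\sigma_{\mathcal X},\alpha}=\{\beta\in(\mathbb{N}^I)^*\mid 0<\beta\le\alpha,\ \sigma_{\mathcal X}^\beta=1\}$. The $k$-tuple $\mathcal{X}$ is of level $V$ if $\mathcal{H}^*_{\sigma_{\mathcal X},\alpha}=\{\beta\in V\mid 0<\beta\le\alpha\}$. Representations of level at most $V$: for a finite-dimensional representation $M$ of $Q$ over $\mathbb{F}_q$, let $\mathcal{H}_M$ be the set of dimension vectors of the indecomposable direct summands of $M\otimes_{\mathbb{F}_q}\overline{\mathbb{F}}_q$. $M$ is of level at most $V$ if $\mathcal{H}_M\subseteq V$. There is a unique polynomial $M_{Q,\alpha,V}(t)\in\mathbb{Z}[t]$ such that for every prime power $q$, $M_{Q,\alpha,V}(q)$ is the number of isomorphism classes of representations of $Q$ over $\mathbb{F}_q$ of dimension vector $\alpha$ and of level at most $V$. *)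

(* Defs.v *)
From HB Require Import structures.
From mathcomp Require Import all_boot all_order all_algebra all_fingroup.
From mathcomp Require Import all_solvable all_field all_character.
From mathcomp Require Import boolp classical_sets.

Set Implicit Arguments.
Unset Strict Implicit.
Unset Printing Implicit Defensive.

Import GroupScope GRing.Theory.
Local Open Scope ring_scope.

(* The values of characters of finite groups are algebraic
   numbers, so complex characters are rendered by MathComp's class functions
   ['CF(G)], with values in [algC]; in particular Hom(F^x, C^x) is the group of
   linear characters of [[set: {unit F}]]. *)

Section LeviParabolic.

Variables (F : finFieldType) (n : nat) (d : seq nat).

(* The row (or column) index [a] lies in the diagonal block numbered
   [reshape_index d a], and [flatten_index d j r] is the [r]-th index of the
   block numbered [j]. *)
Definition levi_pred : pred {'GL_n[F]} := fun h =>
  [forall a : 'I_n.-1.+1, forall b : 'I_n.-1.+1,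
     (reshape_index d a != reshape_index d b) ==> (GLval h a b == 0)].

Definition para_pred : pred {'GL_n[F]} := fun h =>
  [forall a : 'I_n.-1.+1, forall b : 'I_n.-1.+1,
     (reshape_index d b < reshape_index d a)%N ==> (GLval h a b == 0)].

Definition levi_set := [set h | levi_pred h].
Definition para_set := [set h | para_pred h].

Lemma leviP (h : {'GL_n[F]}) :
  reflect (forall a b : 'I_n.-1.+1, reshape_index d a != reshape_index d b -> GLval h a b = 0)
          (h \in levi_set).
Proof.
rewrite inE; apply: (iffP forallP) => H a.
  by move=> b nab; have /forallP/(_ b)/implyP/(_ nab)/eqP := H a.
by apply/forallP => b; apply/implyP => /H/eqP.
Qed.

Lemma paraP (h : {'GL_n[F]}) :
  reflect (forall a b : 'I_n.-1.+1, (reshape_index d b < reshape_index d a)%N ->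
             GLval h a b = 0) (h \in para_set).
Proof.
rewrite inE; apply: (iffP forallP) => H a.
  by move=> b nab; have /forallP/(_ b)/implyP/(_ nab)/eqP := H a.
by apply/forallP => b; apply/implyP => /H/eqP.
Qed.

Lemma levi_group_set : group_set levi_set.
Proof.
apply/group_setP; split=> [|x y /leviP Lx /leviP Ly].
  apply/leviP => a b nab; rewrite GL_1E mxE; case: eqP => // eab.
  by rewrite eab eqxx in nab.
apply/leviP => a b nab; rewrite GL_MxE mxE big1 // => c _.
have [eac|/Lx->] := eqVneq (reshape_index d a) (reshape_index d c).
  by rewrite Ly ?mulr0 // -eac.
by rewrite mul0r.
Qed.

Lemma para_group_set : group_set para_set.
Proof.
apply/group_setP; split=> [|x y /paraP Px /paraP Py].
  apply/paraP => a b nab; rewrite GL_1E mxE; case: eqP => // eab.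
  by rewrite eab ltnn in nab.
apply/paraP => a b ltba; rewrite GL_MxE mxE big1 // => c _.
have [lca|lac] := ltnP (reshape_index d c) (reshape_index d a).
  by rewrite Px ?mul0r.
by rewrite Py ?mulr0 // (leq_trans ltba).
Qed.

Definition Levi := group levi_group_set.
Definition Para := group para_group_set.

(* The projection P -> L erases the entries outside the diagonal blocks;
   [insubd] only makes it total outside of P. *)
Definition levi_part (A : 'M[F]_n.-1.+1) : 'M[F]_n.-1.+1 :=
  \matrix_(a, b) (if reshape_index d a == reshape_index d b then A a b else 0).

Definition para_proj (h : {'GL_n[F]}) : {'GL_n[F]} :=
  insubd (1%g : {'GL_n[F]}) (levi_part h).

Lemma levi_part1 : levi_part 1 = 1.
Proof.
apply/matrixP => a b; rewrite !mxE; case: (eqVneq a b) => [->|_].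
  by rewrite eqxx.
by rewrite if_same.
Qed.

Lemma levi_partM : {in Para &, forall x y : {'GL_n[F]},
  levi_part (GLval (x * y)) = levi_part x * levi_part y}.
Proof.
move=> x y /paraP Px /paraP Py; apply/matrixP => a b.
rewrite GL_MxE !mxE; case: eqP => [eab|/eqP nab].
  apply: eq_bigr => c _; rewrite !mxE -eab.
  case: (ltngtP (reshape_index d a) (reshape_index d c)) => [lt|lt|//].
  - by rewrite (Py c b) ?mulr0 // -eab.
  - by rewrite (Px a c) ?mul0r.
rewrite big1 // => c _; rewrite !mxE.
have [eac|] := eqVneq (reshape_index d a) (reshape_index d c); last by rewrite mul0r.
by rewrite -eac (negPf nab) mulr0.
Qed.

Lemma levi_part_unit : {in Para, forall x : {'GL_n[F]},
  levi_part x \is a GRing.unit}.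
Proof.
move=> x Px; apply/unitrP; exists (levi_part (GLval x^-1%g)).
by rewrite -!levi_partM ?groupV // mulVg mulgV GL_1E levi_part1.
Qed.

Lemma para_projE : {in Para, forall x : {'GL_n[F]},
  GLval (para_proj x) = levi_part x}.
Proof. by move=> x Px; rewrite /para_proj insubdK ?levi_part_unit. Qed.

Lemma para_projM : {in Para &, {morph para_proj : x y / (x * y)%g}}.
Proof.
move=> x y Px Py; apply: val_inj.
rewrite -[LHS]/(GLval _) -[RHS]/(GLval _).
by rewrite GL_ME !para_projE ?groupM // levi_partM.
Qed.

Canonical para_morphism := Morphism para_projM.

Lemma para_proj_im : para_proj @* Para = Levi.
Proof.
apply/setP => h; apply/morphimP/idP => [[x Px _ ->]|Lh].
  apply/leviP => a b nab; rewrite /= para_projE //.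
  by rewrite mxE (negPf nab).
have Ph : h \in Para.
  apply/paraP => a b lt; move/leviP: Lh => -> //.
  by rewrite neq_ltn lt orbT.
exists h => //; apply: val_inj; rewrite -[RHS]/(GLval _) para_projE //.
apply/matrixP => a b; rewrite mxE; case: eqP => // /eqP nab.
by move/leviP: Lh => ->.
Qed.

Definition diag_block (j : nat) (A : 'M[F]_n.-1.+1) : 'M[F]_(nth 0%N d j) :=
  \matrix_(r, c) A (inord (flatten_index d j r)) (inord (flatten_index d j c)).

(* [insubd] only makes the determinant of the [j]-th diagonal block total
   outside of L. *)
Definition block_det (j : nat) (h : {'GL_n[F]}) : {unit F} :=
  insubd (1%g : {unit F}) (\det (diag_block j h)).

Hypothesis sum_d : sumn d = n.

Lemma flatten_index_ord j (r : 'I_(nth 0%N d j)) :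
  (inord (flatten_index d j r) : 'I_n.-1.+1) = flatten_index d j r :> nat.
Proof.
have lt_n : (flatten_index d j r < n)%N by rewrite -[X in (_ < X)%N]sum_d flatten_indexP.
by rewrite inordK // (leq_trans lt_n) // leqSpred.
Qed.

Lemma diag_blockM j : {in Levi &, forall x y : {'GL_n[F]},
  diag_block j (GLval (x * y)) = diag_block j x *m diag_block j y}.
Proof.
move=> x y /leviP Lx _; apply/matrixP => r c; rewrite GL_MxE !mxE.
pose f (e : 'I_(nth 0%N d j)) : 'I_n.-1.+1 := inord (flatten_index d j e).
have fE e : f e = flatten_index d j e :> nat by exact: flatten_index_ord.
pose f' (e : 'I_n.-1.+1) : 'I_(nth 0%N d j) := insubd r (reshape_offset d e).
have fK : cancel f f'.
  move=> e; apply: val_inj; rewrite /f' /insubd insubT fE flatten_indexKr //.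
rewrite (bigID (fun e : 'I_n.-1.+1 => reshape_index d e == j)) /=.
rewrite [X in _ + X]big1 ?addr0 => [|e ne]; last first.
  by rewrite Lx ?mul0r // fE flatten_indexKl 1?eq_sym.
rewrite (reindex_onto f f') /=; last first.
  move=> e /eqP ej; apply: val_inj.
  have lt_n : (e < n)%N.
    have n_gt0 : (0 < n)%N.
      by rewrite -[X in (_ < X)%N]sum_d (leq_ltn_trans _ (flatten_indexP (ltn_ord r))).
    by rewrite -[X in (_ < X)%N](prednK n_gt0).
  have := reshape_offsetP; move=> /(_ d e).
  rewrite sum_d => /(_ lt_n); rewrite ej => lt_o.
  by rewrite /f' /= fE insubdK // -[in LHS]ej reshape_indexK.
apply: eq_big => [e|e _]; last by rewrite !mxE.
by rewrite fE flatten_indexKl // eqxx fK eqxx.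
Qed.

Lemma block_detM j : {in Levi &, {morph block_det j : x y / (x * y)%g}}.
Proof.
have det_unit x : x \in Levi -> \det (diag_block j (GLval x)) \is a GRing.unit.
  move=> Lx; apply/unitrP; exists (\det (diag_block j (GLval x^-1%g))).
  have d1 : \det (diag_block j (GLval (1%g : {'GL_n[F]}))) = 1.
    rewrite -[RHS](det1 F (nth 0%N d j)); congr (\det _); apply/matrixP => r c.
    rewrite mxE GL_1E !mxE -(inj_eq val_inj) -[in RHS](inj_eq val_inj) /=.
    by rewrite !flatten_index_ord /flatten_index eqn_add2l.
  by rewrite -!det_mulmx -!diag_blockM ?groupV // mulVg mulgV d1.
move=> x y Lx Ly; apply: val_inj; rewrite FinRing.val_unitM /block_det.
by rewrite !insubdK ?det_unit ?groupM // diag_blockM // det_mulmx.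
Qed.

End LeviParabolic.

Section HarishChandra.

Variables (F : finFieldType) (n s : nat) (d : s.+1.-tuple nat).
Hypothesis sum_d : sumn d = n.
Variable gam : 'I_s.+1 -> 'CF([set: {unit F}]).

Lemma levi_char_subproof : is_class_fun <<Levi F n d>>
  [ffun h => (\prod_(j < s.+1) gam j (block_det d j h)) *+ (h \in Levi F n d)].
Proof.
rewrite genGid; apply: intro_class_fun => [x y Lx Ly | x /negPf-> //].
rewrite groupJ // Lx; congr (_ *+ _); apply: eq_bigr => j _.
have LyV : y^-1%g \in Levi F n d by rewrite groupV.
pose f := Morphism (@block_detM F n d sum_d j).
have -> : (block_det d j (x ^ y) = block_det d j x ^ block_det d j y)%g.
  exact: (morphJ f).
by rewrite cfunJ ?inE.
Qed.

Definition levi_char : 'CF(Levi F n d) := Cfun 0 levi_char_subproof.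

(* By [para_proj_im] the group [para_proj @* Para] is L itself, so that the
   restriction below is only a transport and [cfMorph] is the inflation. *)
Definition HC_ind : 'CF('GL_n[F]) :=
  'Ind['GL_n[F]] (cfMorph (f := para_morphism F n d) (G := Para F n d)
    ('Res[para_proj d @* Para F n d] levi_char)).

End HarishChandra.

Section AdjointCharacter.

Variables (F : finFieldType) (n g : nat).

Local Notation T := {ffun 'I_g -> 'M[F]_n.-1.+1}.

Definition adj (h : {'GL_n[F]}) (X : T) : T :=
  [ffun l => GLval h *m X l *m GLval h^-1%g].

Definition adj_mx (h : {'GL_n[F]}) : 'M[algC]_#|{: T}| :=
  \matrix_(x, y) (adj h (enum_val y) == enum_val x)%:R.

Lemma adj_mx_repr : mx_repr 'GL_n[F] adj_mx.
Proof.
split=> [|h1 h2 _ _].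
  apply/matrixP => x y; rewrite !mxE; congr (nat_of_bool _)%:R.
  have -> : adj 1%g (enum_val y) = enum_val y.
    by apply/ffunP => l; rewrite ffunE invg1 GL_1E mulmx1 mul1mx.
  by rewrite (inj_eq enum_val_inj) eq_sym.
apply/matrixP => x y; rewrite !mxE.
rewrite (bigD1 (enum_rank (adj h2 (enum_val y)))) //= !mxE enum_rankK eqxx mulr1.
rewrite big1 ?addr0 => [|z nz]; last first.
  rewrite !mxE; case: (adj h2 _ =P enum_val z) => [e|]; last by rewrite mulr0.
  by rewrite e enum_valK eqxx in nz.
congr (nat_of_bool (_ == _))%:R.
by apply/ffunP => l; rewrite !ffunE invMg !GL_MxE !mulmxA.
Qed.

Definition adj_repr := MxRepresentation adj_mx_repr.

Definition Lambda : 'CF('GL_n[F]) := cfRepr adj_repr.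

End AdjointCharacter.

Record quiver := Quiver {
  vertex : finType;
  arrow : finType;
  source : arrow -> vertex;
  target : arrow -> vertex }.

Definition dimvec (Q : quiver) := vertex Q -> nat.

Section Representations.

Variables (K : fieldType) (Q : quiver).

(* Matrices act on row vectors, by right multiplication. *)
Definition rep (b : dimvec Q) :=
  {dffun forall a : arrow Q, 'M[K]_(b (source a), b (target a))}.

Definition rep_iso (b c : dimvec Q) (X : rep b) (Y : rep c) : Prop :=
  exists (f : forall v, 'M[K]_(b v, c v)) (f' : forall v, 'M[K]_(c v, b v)),
    [/\ forall v, f v *m f' v = 1%:M,
        forall v, f' v *m f v = 1%:M &
        forall a, X a *m f (target a) = f (source a) *m Y a].

Definition dim_add (b c : dimvec Q) : dimvec Q := fun v => (b v + c v)%N.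

Definition rep_sum (b c : dimvec Q) (X : rep b) (Y : rep c) :
    rep (dim_add b c) :=
  [ffun a : arrow Q => block_mx (X a) 0 0 (Y a)].

Definition dim_zero (b : dimvec Q) : Prop := forall v, b v = 0%N.

Definition indecomposable (b : dimvec Q) (X : rep b) : Prop :=
  ~ dim_zero b /\
  forall (c e : dimvec Q) (Y : rep c) (Z : rep e),
    rep_iso X (rep_sum Y Z) -> dim_zero c \/ dim_zero e.

Definition indec_dims (b : dimvec Q) (X : rep b) : set (dimvec Q) :=
  [set c | exists (e : dimvec Q) (Y : rep c) (Z : rep e),
             indecomposable Y /\ rep_iso X (rep_sum Y Z)]%classic.

End Representations.

Definition alg_closure (F : countFieldType) : countClosedFieldType :=
  projT1 (countable_algebraic_closure F).

Definition to_closure (F : countFieldType) : {rmorphism F -> alg_closure F} :=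
  sval (projT2 (countable_algebraic_closure F)).

Definition rep_closure (F : finFieldType) (Q : quiver) (b : dimvec Q)
    (X : rep F b) : rep (alg_closure F) b :=
  [ffun a : arrow Q => map_mx (to_closure F) (X a)].

Definition level_at_most (F : finFieldType) (Q : quiver) (b : dimvec Q)
    (V : set (dimvec Q)) (X : rep F b) : Prop :=
  (indec_dims (rep_closure X) `<=` V)%classic.

Definition nb_isoclasses (F : finFieldType) (Q : quiver) (b : dimvec Q)
    (V : set (dimvec Q)) : nat :=
  #|equivalence_partition (fun X Y : rep F b => `[< rep_iso X Y >])
      [set X : rep F b | `[< level_at_most V X >]]|.

(* [M] is the polynomial M_{Q,b,V}: it counts over all finite fields at once,
   so that it is unique. *)
Definition is_counting_poly (Q : quiver) (b : dimvec Q) (V : set (dimvec Q))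
    (M : {poly int}) : Prop :=
  forall F : finFieldType, M.[#|F|%:R] = (nb_isoclasses F b V)%:R.

Section Star.

Variables (k g : nat) (s : 'I_k -> nat).

(* [None] is the central vertex, and [Some (Tagged _ j)] is the vertex
   [i, j.+1] of the [i]-th leg. *)
Definition star_vertex : finType := option {i : 'I_k & 'I_(s i)}.

Definition star_node (i : 'I_k) (j : 'I_(s i).+1) : star_vertex :=
  omap (fun j' => Tagged (fun i => 'I_(s i)) j') (unlift ord0 j).

Definition star_arrow : finType := ('I_g + {i : 'I_k & 'I_(s i)})%type.

Definition star_source (a : star_arrow) : star_vertex :=
  match a with
  | inl _ => None
  | inr u => star_node (lift ord0 (tagged u))
  end.

Definition star_target (a : star_arrow) : star_vertex :=
  match a with
  | inl _ => None
  | inr u => star_node (widen_ord (leqnSn (s (tag u))) (tagged u))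
  end.

Definition star : quiver := Quiver star_source star_target.

Definition star_alpha (n : nat) (d : forall i, (s i).+1.-tuple nat) :
    dimvec star :=
  fun v => match v with
  | None => n
  | Some u =>
      \sum_(h < (s (tag u)).+1 | (lift ord0 (tagged u) <= h)%N)
        tnth (d (tag u)) h
  end%N.

Definition nonincreasing_dims : set (dimvec star) :=
  [set b | forall (i : 'I_k) (j : 'I_(s i)),
     (b (star_node (lift ord0 j)) <=
      b (star_node (widen_ord (leqnSn (s i)) j)))%N]%classic.

Definition pos_below (a : dimvec star) : set (dimvec star) :=
  [set b | ~ dim_zero b /\ forall v, (b v <= a v)%N]%classic.

Variables (F : finFieldType).
Variable gam : forall i : 'I_k, 'I_(s i).+1 -> 'CF([set: {unit F}]).

Definition sigma (v : star_vertex) : 'CF([set: {unit F}]) :=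
  match v with
  | None => \prod_(i < k) gam (ord0 : 'I_(s i).+1)
  | Some u => gam (lift ord0 (tagged u)) *
              (gam (widen_ord (leqnSn (s (tag u))) (tagged u)))^-1
  end.

Definition sigma_exp (b : dimvec star) : 'CF([set: {unit F}]) :=
  \prod_(v : star_vertex) sigma v ^+ b v.

Definition H_star (a : dimvec star) : set (dimvec star) :=
  (nonincreasing_dims `&` pos_below a `&` [set b | sigma_exp b = 1])%classic.

Definition of_level (a : dimvec star) (V : set (dimvec star)) : Prop :=
  H_star a = (V `&` pos_below a)%classic.

End Star.

(* Main.v *)
(* Expanding the induced characters, the inner product counts configurations [p] of [g]
   endomorphisms and [k] flags (given by adapted bases) of F^n, each weighted by the sum of
   the product of the [gamma_i] over its stabilizer; the sum is the order of the stabilizer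
   or zero, according to whether this character of the stabilizer is trivial. Since
   configurations up to isomorphism are the representations of the star-shaped quiver with
   injective legs, the stabilizers being the automorphism groups and the character being
   f |-> prod_v sigma_v(det f_v), the inner product is the number of isomorphism classes of
   representations X with injective legs such that this character is trivial on Aut(X).

   This triviality holds if and only if sigma^c = 1 for every dimension vector c of an
   indecomposable summand of X over the algebraic closure. If an automorphism of X is
   semisimple, its eigenspaces are summands over the closure and Frobenius permutes them,
   so its character is a product of values of the sigma^c. Conversely, a summand of
   dimension c defined over an extension K of F has the scalars of K as automorphisms; by
   restriction of scalars they act on a power X^r, with determinants N_{K/F}(z)^(c v), and
   the character is trivial on all of Aut(X^r) = GL_r(End X) since the finite ring End X has
   stable range 1. Finally, a representation whose legs are not all injective has an
   interval summand supported on a leg, of dimension vector not in (N^I)^*. *)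

From HB Require Import structures.
Require Import Defs.
From mathcomp Require Import all_boot all_order all_algebra all_fingroup.
From mathcomp Require Import all_solvable all_field all_character.
From mathcomp Require Import boolp classical_sets.
From mathcomp Require Import ring.
Import GroupScope GRing.Theory.
Local Open Scope ring_scope.

Set Implicit Arguments.
Unset Strict Implicit.
Unset Printing Implicit Defensive.

(** Neither a field between [F] and its closure nor a full decomposition of [X] into indecomposables
    is constructed. Summands are handled as retracts, and an element of the extension generated by a
    root of unity [z] is a polynomial over [F] known by its value at [z]. Triviality is then tested
    on one norm only, so [z] is taken primitive of order [q^R - 1], which makes its norm a generator
    of the multiplicative group of [F]. In the other direction, raising an automorphism to a power
    of [q] takes the place of the Jordan decomposition: it changes no determinant, these lying in
    [F], and it gives a semisimple automorphism once the power is large. In the final count, the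
    stabilizers of the configurations isomorphic to a fixed one have orders that add up to the order
    of [GL_n] times those of the parabolic subgroups, whatever the class; this is exactly the
    denominator of the inner product. *)

Lemma sum_equivalence_classes (I T : finType) (R : rel T) (E : {set T}) (rho : I -> T)
    (c : I -> nat) H :
    {in E & &, equivalence_rel R} ->
    (forall Y, Y \in E -> (\sum_(p | (rho p \in E) && R Y (rho p)) c p)%N = H) ->
  (\sum_(p | rho p \in E) c p)%N = (#|equivalence_partition R E| * H)%N.
Proof.
move=> eqR sumH; set P := equivalence_partition R E.
have partP : finset.partition P E := equivalence_partitionP eqR.
have [/eqP coverP tiP P0] := and3P partP.
rewrite (partition_big (fun p => finset.pblock P (rho p)) (mem P)) /= => [|p Ep]; last first.
  by rewrite pblock_mem // coverP.
rewrite -sum_nat_const; apply: eq_bigr => B PB.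
have [Y YB] : exists Y, Y \in B.
  by apply/finset.set0Pn; apply: contraNneq P0 => <-.
have EY : Y \in E by rewrite -coverP; apply/finset.bigcupP; exists B.
rewrite -(sumH Y EY); apply: eq_bigl => p; case Ep: (rho p \in E) => //=.
by rewrite -(def_pblock tiP PB YB) eq_sym eq_pblock ?coverP // (pblock_equivalence_partition eqR).
Qed.

(** The bound on [j] keeps both the preperiod and the period of a sequence of powers at most [#|T|],
    so that a single factorial serves all elements. *)
Lemma nat_collision (T : finType) (f : nat -> T) :
  exists i j, [/\ (i < j)%N, (j <= #|T|)%N & f i = f j].
Proof.
have : ~~ injectiveb (fun i : 'I_#|T|.+1 => f i).
  by apply/negP => /injectiveP/leq_card; rewrite card_ord ltnn.
case/injectivePn => i [j neq_ij eq_ij].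
have [lt|lt|/val_inj e] := ltngtP i j.
- by exists i, j; split; rewrite // -ltnS ltn_ord.
- by exists j, i; split; rewrite // -ltnS ltn_ord.
- by rewrite e eqxx in neq_ij.
Qed.

(** * Determinants, stable range and trivial characters of GL_r *)

(** Sylvester's identity: both sides are the determinant of [S], cleared by a lower or by an upper
    unitriangular matrix. *)
Lemma det_1_mulmxC (R : comPzRingType) m n (A : 'M[R]_(m, n)) (B : 'M[R]_(n, m)) :
  \det (1%:M + A *m B) = \det (1%:M + B *m A).
Proof.
pose S := block_mx 1%:M (- A) B 1%:M.
have dl : \det (block_mx 1%:M 0 (- B) 1%:M *m S) = \det (1%:M + B *m A).
  rewrite mulmx_block !mul1mx !mul0mx ?mulmx1 !addr0 mulNmx mulmxN opprK.
  by rewrite addNr addrC det_ublock det1 mul1r.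
have dr : \det (block_mx 1%:M A 0 1%:M *m S) = \det (1%:M + A *m B).
  rewrite mulmx_block !mul1mx !mul0mx ?mulmx1 !add0r.
  by rewrite addNr det_lblock det1 mulr1.
rewrite -dl -dr !det_mulmx det_ublock det_lblock !det1.
by rewrite !mul1r.
Qed.

(** Conjugation in rectangular form, since it is applied between index types such as [1 * w] and [w]
    that differ. *)
Lemma det_mulmx_conj (R : comPzRingType) m n (A : 'M[R]_(m, n)) (B : 'M[R]_(n, m)) M :
  A *m B = 1%:M -> B *m A = 1%:M -> \det (A *m M *m B) = \det M.
Proof.
move=> AB BA; rewrite -[in LHS](subrK 1%:M M) addrC mulmxDr mulmxDl mulmx1 AB.
by rewrite -mulmxA det_1_mulmxC -mulmxA BA mulmx1 addrC subrK.
Qed.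

Section StableRange.

Variable R : finPzRingType.
Implicit Types a b x y e : R.

Let N := factorial #|R|.

(** The powers of [a] become periodic, with preperiod and period at most [#|R|]. The factorial [N]
    is at least the preperiod and a multiple of the period, so the exponents [N] and [2 * N] give
    the same power. *)
Lemma expr_card_idem a : a ^+ N * a ^+ N = a ^+ N.
Proof.
have [i [j [lt_ij le_j Eij]]] := nat_collision (fun i => a ^+ i).
have [p p_gt0 Dj] : exists2 p, (0 < p)%N & j = (i + p)%N.
  by exists (j - i)%N; rewrite ?subn_gt0 // subnKC // ltnW.
have le_ip : (i + p <= #|R|)%N by rewrite -Dj.
have Eip : a ^+ (i + p) = a ^+ i by rewrite -Dj Eij.
have per m t : (i <= m)%N -> a ^+ (m + t * p) = a ^+ m.
  move=> le_im; elim: t => [|t IHt]; first by rewrite addn0.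
  rewrite mulSn addnCA addnC -{}IHt.
  have le_it := leq_trans le_im (leq_addr (t * p) m).
  by rewrite -{1}(subnK le_it) -addnA exprD Eip -exprD subnK.
have pN : (p %| N)%N.
  by apply: dvdn_fact; rewrite p_gt0 (leq_trans (leq_addl _ _) le_ip).
have iN : (i <= N)%N.
  by apply: leq_trans (fact_geq _); apply: leq_trans le_ip; apply: leq_addr.
by rewrite -exprD -{2}(divnK pN) per.
Qed.

Let N_gt0 : (0 < N)%N. Proof. exact: fact_gt0. Qed.

(* [e = a ^+ N] is the projector on the stable part of [a] (Fitting), so that [a] is
   nilpotent on the complementary part [f]. There [y * b] fixes a nonzero [w] killed by
   [a], hence a power [eps] of [f * y * b * f] is a nonzero idempotent, and [t] is chosen
   so that [a + t * b] agrees with [a] modulo [f] and fixes [eps]. *)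
Lemma stable_range_step a b x y : x * a + y * b = 1 -> a ^+ N != 1 ->
  exists t, (#|[set (a ^+ N * r)%R | r : R]| < #|[set ((a + t * b) ^+ N * r)%R | r : R]|)%N.
Proof.
move=> Exy neq1; pose e := a ^+ N.
have [f fE] : {f | f = 1 - e} by exists (1 - e).
have ee : e * e = e by exact: expr_card_idem.
have ef : e * f = 0 by rewrite fE mulrBr mulr1 ee subrr.
have fe : f * e = 0 by rewrite fE mulrBl mul1r ee subrr.
have ff : f * f = f by rewrite {2}fE mulrBr fe subr0 mulr1.
have ca : GRing.comm a e by apply: commrX.
have caf : a * f = f * a by rewrite fE mulrBr mulrBl ca mulr1 mul1r.
have f0 : f != 0 by rewrite fE subr_eq0 eq_sym.
have [w [w0 fw aw]] : exists w, [/\ w != 0, f * w = w & a * w = 0].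
  have aNf : exists m, a ^+ m * f == 0 by exists N; rewrite -/e ef.
  have aX m : a ^+ m * f = f * a ^+ m.
    by elim: m => [|m IHm]; rewrite ?mulr1 ?mul1r // exprS -mulrA IHm !mulrA caf.
  case: (ex_minnP aNf) => -[|m] /eqP am0 min_m.
    by rewrite expr0 mul1r in am0; rewrite am0 eqxx in f0.
  exists (a ^+ m * f); split; last by rewrite mulrA -exprS.
    by apply/negP => /min_m; rewrite ltnn.
  by rewrite aX mulrA ff.
pose z := f * y * b * f.
have f_z : f = f * x * a * f + z.
  rewrite -[LHS]ff -[X in X * f = _]mulr1 -Exy.
  by rewrite mulrDr mulrDl !mulrA.
have zw : z * w = w.
  by rewrite -[RHS]fw [X in _ = X * w]f_z mulrDl -!mulrA fw aw !mulr0 add0r.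
pose eps := z ^+ N.
have epsw : eps * w = w.
  by rewrite /eps; elim: (N) => [|m IHm]; rewrite ?mul1r // exprSr -mulrA zw.
have eps0 : eps != 0.
  by apply: contraNneq w0 => E; rewrite -epsw E mul0r.
have epseps : eps * eps = eps by exact: expr_card_idem.
have feps : f * eps = eps.
  by rewrite /eps -(prednK N_gt0) exprS /z !mulrA ff.
(* The tail [z ^+ N.-1 * f * y] completes [b * f] to [z ^+ N = eps], whence
   [t * b * f = (f - a * f) * eps]; the head is killed by [e] on the left. *)
pose t := (f - a * f) * eps * z ^+ N.-1 * f * y.
have tbf : t * b * f = (f - a * f) * eps.
  have -> : t * b * f = (f - a * f) * eps * (z ^+ N.-1 * z) by rewrite /t /z !mulrA.
  by rewrite -exprSr prednK // -mulrA epseps.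
have aeps : (a + t * b) * eps = eps.
  rewrite -{1}feps mulrA mulrDl tbf mulrDl -mulrA feps.
  by rewrite -[_ * eps * eps]mulrA epseps mulrBl feps -mulrA feps addrC subrK.
exists t; set c := a + t * b.
have ec : e * c = a * e.
  rewrite mulrDr -ca /t !mulrA mulrBr ef caf mulrA ef mul0r subrr !mul0r addr0.
  by [].
have ecX m : e * c ^+ m = a ^+ m * e.
  elim: m => [|m IHm]; first by rewrite mulr1 mul1r.
  by rewrite exprSr mulrA IHm -mulrA ec mulrA -exprSr.
have cXeps m : c ^+ m * eps = eps.
  by elim: m => [|m IHm]; rewrite ?mul1r // exprSr -mulrA aeps.
(* Multiplication by [e] maps [S] onto the right ideal of [a ^+ N] and kills the nonzero element
   [eps] of [S], so the inequality is strict. *)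
pose S := [set c ^+ N * r | r : R].
have -> : [set a ^+ N * r | r : R] = [set e * r | r in S].
  apply/setP => u; apply/imsetP/imsetP => [[r _ ->]|[_ /imsetP[r _ ->] ->]].
    by exists (c ^+ N * r); rewrite ?imset_f // mulrA ecX ee.
  by exists r; rewrite // mulrA ecX ee.
rewrite ltn_neqAle leq_imset_card andbT; apply/negP => /imset_injP inj_e.
have S0 : 0 \in S by apply/imsetP; exists 0; rewrite ?mulr0.
have Seps : eps \in S by apply/imsetP; exists eps; rewrite ?cXeps.
case/eqP: eps0; apply: inj_e => //.
by rewrite mulr0 -feps mulrA ef mul0r.
Qed.

(** Take [t] for which the right ideal of [(a + t * b) ^+ N] is largest. The relation persists as
    [x * (a + t * b) + (y - x * t) * b = 1], so by the previous step this power can only be 1. *)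
Lemma finite_stable_range a b x y : x * a + y * b = 1 ->
  exists t c, c * (a + t * b) = 1 /\ (a + t * b) * c = 1.
Proof.
move=> Exy.
pose m t := #|[set (a + t * b) ^+ N * r | r : R]|.
have [t _ max_t] := arg_maxnP m (isT : predT (0 : R)).
exists t, ((a + t * b) ^+ N.-1).
suff /eqP E1 : (a + t * b) ^+ N == 1 by rewrite -exprS -exprSr prednK.
apply/negPn/negP => /(stable_range_step (b := b) (x := x) (y := y - x * t)) [].
  by rewrite mulrDr mulrBl !mulrA addrACA subrr addr0.
move=> t'; rewrite -addrA -mulrDl ltnNge; apply/negP; rewrite negbK; exact: max_t.
Qed.

End StableRange.

Section BlockDiag.

Variables (R : pzRingType) (T : comPzRingType).
Variable phi : forall r, 'M[R]_r -> T.
Hypothesis phiM : forall r, {morph @phi r : A B / A *m B >-> A * B}.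
Hypothesis phiC : forall r s (A : 'M[R]_(r, s)) (B : 'M[R]_(s, r)),
  phi (1%:M + A *m B) = phi (1%:M + B *m A).

(** Each factor is 1 plus a product through the smaller size, and [phiC] then erases the identity
    block. Only multiplicativity and Sylvester's identity are assumed, so that [phi] can be a
    determinant of flattened matrices or a product of characters of such determinants. *)
Lemma phi_block_diag r s (A : 'M[R]_r) (D : 'M[R]_s) :
  phi (block_mx A 0 0 D) = phi A * phi D.
Proof.
have -> : block_mx A 0 0 D = block_mx A 0 0 1%:M *m block_mx 1%:M 0 0 D.
  by rewrite mulmx_block ?mulmx1 ?mulmx0 ?mul0mx ?mul1mx !addr0 !add0r.
rewrite phiM; congr (_ * _).
  have -> : block_mx A 0 0 1%:M = 1%:M + col_mx (A - 1%:M) 0 *m (row_mx 1%:M 0 : 'M[R]_(r, r + s)).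
    rewrite mul_col_row ?mulmx1 ?mulmx0 ?mul0mx scalar_mx_block add_block_mx.
    by rewrite addrC subrK !addr0.
  by rewrite phiC mul_row_col ?mul0mx addr0 ?mul1mx addrC subrK.
have -> : block_mx 1%:M 0 0 D = 1%:M + col_mx 0 (D - 1%:M) *m (row_mx 0 1%:M : 'M[R]_(s, r + s)).
  rewrite mul_col_row ?mulmx1 ?mulmx0 ?mul0mx scalar_mx_block add_block_mx.
  by rewrite [1%:M + (_ - _)]addrC subrK !addr0.
by rewrite phiC mul_row_col ?mul0mx add0r ?mul1mx addrC subrK.
Qed.

End BlockDiag.

Section K1.

Variables (R : finPzRingType) (T : comPzRingType).
Variable phi : forall r, 'M[R]_r -> T.
Hypothesis phiM : forall r, {morph @phi r : A B / A *m B >-> A * B}.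
Hypothesis phiC : forall r s (A : 'M[R]_(r, s)) (B : 'M[R]_(s, r)),
  phi (1%:M + A *m B) = phi (1%:M + B *m A).
Hypothesis phi_unit : forall a b : R, a * b = 1 -> b * a = 1 ->
  phi (a%:M : 'M_1) = 1.

(** Multiplicativity alone makes [phi 1] only an idempotent, so its value is carried by [phiC] to
    size 1, where [phi_unit] applies. The transvections below have this form. *)
Let phi0 r s (A : 'M[R]_(r, s)) (B : 'M[R]_(s, r)) : B *m A = 0 ->
  phi (1%:M + A *m B) = 1.
Proof.
move=> BA; rewrite phiC BA -[X in phi (_ + X)](mulmx0 s (0 : 'M[R]_(s, 1))).
by rewrite phiC mulmx0 addr0 (@phi_unit 1 1) ?mulr1.
Qed.

Let phi_ublock r s (B : 'M[R]_(r, s)) : phi (block_mx 1%:M B 0 1%:M) = 1.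
Proof.
have -> : block_mx 1%:M B 0 1%:M = 1%:M + col_mx 1%:M 0 *m (row_mx 0 B : 'M[R]_(r, r + s)).
  by rewrite mul_col_row ?mul1mx ?mul0mx scalar_mx_block add_block_mx !addr0 add0r.
by rewrite phi0 // mul_row_col ?mulmx0 ?mul0mx addr0.
Qed.

Let phi_lblock r s (B : 'M[R]_(s, r)) : phi (block_mx 1%:M 0 B 1%:M) = 1.
Proof.
have -> : block_mx 1%:M 0 B 1%:M = 1%:M + col_mx 0 1%:M *m (row_mx B 0 : 'M[R]_(s, r + s)).
  by rewrite mul_col_row ?mul1mx ?mul0mx scalar_mx_block add_block_mx !addr0 add0r.
by rewrite phi0 // mul_row_col ?mulmx0 ?mul0mx addr0.
Qed.

(* By the stable range condition, row operations bring any invertible matrix to a matrix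
   with an invertible corner, which is then cleared. *)
Lemma K1_trivial r (U U' : 'M[R]_r) : U *m U' = 1%:M -> U' *m U = 1%:M -> phi U = 1.
Proof.
elim: r U U' => [|r IHr] U U' UU' U'U.
  rewrite [U]flatmx0 -[0](flatmx0 1%:M) -(addr0 1%:M).
  by rewrite -[X in _ + X](mulmx0 0 (0 : 'M[R]_(0, 0))) phi0 // ?mulmx0.
rewrite -[r.+1]/(1 + r)%N in U U' UU' U'U *.
have E : ulsubmx U' *m ulsubmx U + ursubmx U' *m dlsubmx U = 1%:M.
  move: U'U; rewrite -[U]submxK -[U']submxK mulmx_block scalar_mx_block.
  by case/eq_block_mx; rewrite !submxK.
set a := ulsubmx U in E; set c := dlsubmx U in E.
set x := ulsubmx U' in E; set y := ursubmx U' in E.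
(* The first columns give [x * a + y *m c = 1]; the scalar [y *m c] plays the role of [b], with
   coefficient 1, although [c] is a column of length [r]. *)
have [t [a' [a'a aa']]] : exists t a' : 'M[R]_1,
    a' *m (a + t *m (y *m c)) = 1%:M /\ (a + t *m (y *m c)) *m a' = 1%:M.
  have := congr1 (fun A : 'M[R]_1 => A 0 0) E.
  rewrite mxE [x]mx11_scalar [a]mx11_scalar -scalar_mxM mxE mulr1n.
  rewrite [y *m c]mx11_scalar !mxE mulr1n -[X in _ + X]mul1r.
  case/finite_stable_range => t [a' [e1 e2]].
  exists t%:M, a'%:M.
  by rewrite -!scalar_mxM -raddfD /= -!scalar_mxM e1 e2.
pose E1 : 'M[R]_(1 + r) := block_mx 1%:M (t *m y) 0 1%:M.
pose E1' : 'M[R]_(1 + r) := block_mx 1%:M (- (t *m y)) 0 1%:M.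
have E1K : E1' *m E1 = 1%:M.
  rewrite mulmx_block ?mul1mx ?mul0mx ?mulmx1 ?mulmx0 !addr0 add0r subrr.
  by rewrite -scalar_mx_block.
have E1K' : E1 *m E1' = 1%:M.
  rewrite mulmx_block ?mul1mx ?mul0mx ?mulmx1 ?mulmx0 !addr0 add0r addNr.
  by rewrite -scalar_mx_block.
pose b1 := ursubmx (E1 *m U); pose d1 := drsubmx (E1 *m U).
set a1 := a + _ in a'a aa'.
have EU : E1 *m U = block_mx a1 b1 c d1.
  rewrite -[LHS]submxK; congr block_mx.
    by rewrite -[U in LHS]submxK mulmx_block block_mxKul mul1mx -mulmxA.
  by rewrite -[U in LHS]submxK mulmx_block block_mxKdl mul0mx add0r mul1mx.
(* The Schur complement of the invertible corner [a1]. *)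
pose D := d1 - c *m a' *m b1.
pose Lo : 'M[R]_(1 + r) := block_mx 1%:M 0 (c *m a') 1%:M.
pose Lo' : 'M[R]_(1 + r) := block_mx 1%:M 0 (- (c *m a')) 1%:M.
pose Up : 'M[R]_(1 + r) := block_mx 1%:M (a' *m b1) 0 1%:M.
pose Up' : 'M[R]_(1 + r) := block_mx 1%:M (- (a' *m b1)) 0 1%:M.
have LoK : Lo *m Lo' = 1%:M.
  rewrite mulmx_block ?mul1mx ?mul0mx ?mulmx1 ?mulmx0 !addr0 add0r subrr.
  by rewrite -scalar_mx_block.
have LoK' : Lo' *m Lo = 1%:M.
  rewrite mulmx_block ?mul1mx ?mul0mx ?mulmx1 ?mulmx0 !addr0 add0r addNr.
  by rewrite -scalar_mx_block.
have UpK : Up *m Up' = 1%:M.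
  rewrite mulmx_block ?mul1mx ?mul0mx ?mulmx1 ?mulmx0 !addr0 add0r addNr.
  by rewrite -scalar_mx_block.
have UpK' : Up' *m Up = 1%:M.
  rewrite mulmx_block ?mul1mx ?mul0mx ?mulmx1 ?mulmx0 !addr0 add0r subrr.
  by rewrite -scalar_mx_block.
have EB : E1 *m U = Lo *m block_mx a1 0 0 D *m Up.
  rewrite EU !mulmx_block ?mul1mx ?mul0mx ?mulmx1 ?mulmx0 !addr0 !add0r.
  by rewrite !mulmxA aa' ?mul1mx -(mulmxA c) a'a ?mulmx1 addrC subrK.
(* The inverse of the block diagonal matrix; its lower right corner is the inverse of [D] required
   by the induction. *)
pose W := Up *m U' *m E1' *m Lo.
have BE : block_mx a1 0 0 D = Lo' *m E1 *m U *m Up'.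
  by rewrite -[Lo' *m E1 *m U]mulmxA EB !mulmxA LoK' ?mul1mx -mulmxA UpK ?mulmx1.
have BW : block_mx a1 0 0 D *m W = 1%:M.
  rewrite BE /W -!mulmxA (mulmxA Up') UpK' ?mul1mx (mulmxA U) UU' ?mul1mx.
  by rewrite (mulmxA E1) E1K' ?mul1mx.
have WB : W *m block_mx a1 0 0 D = 1%:M.
  rewrite BE /W -!mulmxA (mulmxA Lo) LoK ?mul1mx (mulmxA E1') E1K ?mul1mx.
  by rewrite (mulmxA U') U'U ?mul1mx UpK.
have DW : D *m drsubmx W = 1%:M.
  move: BW; rewrite -[W]submxK mulmx_block scalar_mx_block.
  by case/eq_block_mx => _ _ _; rewrite submxK ?mul0mx add0r.
have WD : drsubmx W *m D = 1%:M.
  move: WB; rewrite -[W]submxK mulmx_block scalar_mx_block.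
  by case/eq_block_mx => _ _ _; rewrite submxK ?mulmx0 add0r.
have -> : phi U = phi (E1 *m U) by rewrite phiM phi_ublock mul1r.
rewrite EB !phiM phi_lblock phi_ublock mulr1 mul1r (phi_block_diag phiM phiC).
rewrite (IHr D _ DW WD) mulr1 [a1]mx11_scalar.
apply: (@phi_unit _ (a' 0 0)).
  move: aa'; rewrite {1}[a1]mx11_scalar {1}[a']mx11_scalar -scalar_mxM.
  by move/(congr1 (fun A : 'M[R]_1 => A 0 0)); rewrite [LHS]mxE [RHS]mxE.
move: a'a; rewrite {1}[a1]mx11_scalar {1}[a']mx11_scalar -scalar_mxM.
by move/(congr1 (fun A : 'M[R]_1 => A 0 0)); rewrite [LHS]mxE [RHS]mxE.
Qed.

End K1.

(** * Matrices over a ring acting by matrices, flattened to larger matrices *)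

Definition mxvec_unindex m n (x : 'I_(m * n)) : 'I_m * 'I_n :=
  enum_val (cast_ord (esym (mxvec_cast m n)) x).

Lemma mxvec_indexK m n (i : 'I_m) (j : 'I_n) : mxvec_unindex (mxvec_index i j) = (i, j).
Proof. by rewrite /mxvec_unindex cast_ordK enum_rankK. Qed.

Lemma mxvec_unindexK m n (x : 'I_(m * n)) :
  mxvec_index (mxvec_unindex x).1 (mxvec_unindex x).2 = x.
Proof. by case/mxvec_indexP: x => i j; rewrite mxvec_indexK. Qed.

Lemma mxvec_unindex_inj m n : injective (@mxvec_unindex m n).
Proof. by move=> x y E; rewrite -[x]mxvec_unindexK -[y]mxvec_unindexK E. Qed.

Lemma sum_mxvec_unindex (V : nmodType) m n (f : 'I_m -> 'I_n -> V) :
  \sum_(x < m * n) f (mxvec_unindex x).1 (mxvec_unindex x).2 = \sum_i \sum_j f i j.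
Proof.
rewrite pair_bigA /= (reindex _ (curry_mxvec_bij m n)) /=.
by apply: eq_bigr => -[i j] _; rewrite mxvec_indexK.
Qed.

(** Exchanging the inner and outer block indices is conjugation by the permutation matrix [P]. *)
Lemma det_mxvec_swap (T : comPzRingType) m n (M : 'M[T]_(m * n)) (N : 'M[T]_(n * m)) :
    (forall i j k l, M (mxvec_index i k) (mxvec_index j l) =
                     N (mxvec_index k i) (mxvec_index l j)) ->
  \det M = \det N.
Proof.
move=> MN; pose sw p q (x : 'I_(p * q)) := mxvec_index (mxvec_unindex x).2 (mxvec_unindex x).1.
have swK p q : cancel (@sw p q) (@sw q p).
  by case/mxvec_indexP => i j; rewrite /sw !mxvec_indexK.
pose P p q : 'M[T]_(p * q, q * p) := \matrix_(x, y) (sw p q x == y)%:R.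
have PP p q : P p q *m P q p = 1%:M.
  apply/matrixP => x y; rewrite !mxE (bigD1 (sw _ _ x)) //= big1 => [|c nc]; last first.
    by rewrite !mxE eq_sym (negPf nc) mul0r.
  by rewrite !mxE eqxx mul1r addr0 swK.
have -> : M = P _ _ *m N *m P _ _.
  apply/matrixP => x y; rewrite !mxE (bigD1 (sw _ _ y)) //= big1 => [|c nc]; last first.
    by rewrite !mxE -(inj_eq (can_inj (swK _ _))) swK (negPf nc) mulr0.
  rewrite !mxE swK eqxx mulr1 addr0 (bigD1 (sw _ _ x)) //= big1 => [|c nc]; last first.
    by rewrite !mxE eq_sym (negPf nc) mul0r.
  rewrite !mxE eqxx mul1r addr0.
  by case/mxvec_indexP: x => i k; case/mxvec_indexP: y => j l; rewrite /sw !mxvec_indexK.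
by rewrite det_mulmx_conj.
Qed.

Section Flatten.

Variables (R : pzRingType) (T : comPzRingType) (w : nat).
Variable rho : {rmorphism R -> 'M[T]_w}.

Definition flatten_mx m n (A : 'M[R]_(m, n)) : 'M[T]_(m * w, n * w) :=
  \matrix_(x, y) rho (A (mxvec_unindex x).1 (mxvec_unindex y).1)
                     (mxvec_unindex x).2 (mxvec_unindex y).2.

Lemma flatten_mxD m n (A B : 'M[R]_(m, n)) :
  flatten_mx (A + B) = flatten_mx A + flatten_mx B.
Proof. by apply/matrixP => x y; rewrite !mxE rmorphD mxE. Qed.

Lemma flatten_mxM m n p (A : 'M[R]_(m, n)) (B : 'M[R]_(n, p)) :
  flatten_mx (A *m B) = flatten_mx A *m flatten_mx B.
Proof.
apply/matrixP => x y; rewrite !mxE rmorph_sum summxE.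
under [RHS]eq_bigr do rewrite !mxE.
rewrite (sum_mxvec_unindex (fun j k => rho (A (mxvec_unindex x).1 j) (mxvec_unindex x).2 k *
  rho (B j (mxvec_unindex y).1) k (mxvec_unindex y).2)).
by apply: eq_bigr => j _; rewrite rmorphM mxE.
Qed.

Lemma flatten_mx1 m : flatten_mx (1%:M : 'M[R]_m) = 1%:M.
Proof.
apply/matrixP => x y; rewrite !mxE -(inj_eq (@mxvec_unindex_inj m w)).
case: (mxvec_unindex x) (mxvec_unindex y) => [i a] [j b] /=; rewrite xpair_eqE.
by case: eqP => _; rewrite ?rmorph1 ?rmorph0 mxE.
Qed.

Lemma det_flatten_mxC m n (A : 'M[R]_(m, n)) (B : 'M[R]_(n, m)) :
  \det (flatten_mx (1%:M + A *m B)) = \det (flatten_mx (1%:M + B *m A)).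
Proof. by rewrite !flatten_mxD !flatten_mxM !flatten_mx1 det_1_mulmxC. Qed.

Lemma det_flatten_scalar1 (a : R) : \det (flatten_mx (a%:M : 'M_1)) = \det (rho a).
Proof.
pose P : 'M[T]_(1 * w, w) := \matrix_(x, y) ((mxvec_unindex x).2 == y)%:R.
have PP : P *m P^T = 1%:M.
  apply/matrixP => x y; rewrite !mxE -(inj_eq (@mxvec_unindex_inj _ _)).
  rewrite (bigD1 (mxvec_unindex x).2) //= big1 => [|c nc]; last first.
    by rewrite !mxE eq_sym (negPf nc) mul0r.
  rewrite !mxE eqxx mul1r addr0 eq_sym; case: (mxvec_unindex x) (mxvec_unindex y) => [i b] [j c].
  by rewrite !ord1.
have PTP : P^T *m P = 1%:M.
  apply/matrixP => x y; rewrite !mxE (bigD1 (mxvec_index 0 x)) //= big1 => [|c nc]; last first.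
    rewrite !mxE; case: eqP => // E; last by rewrite mul0r.
    case/eqP: nc; rewrite -[c]mxvec_unindexK E; congr mxvec_index; exact: ord1.
  by rewrite !mxE mxvec_indexK /= eqxx mul1r addr0.
have E : flatten_mx (a%:M : 'M_1) = P *m rho a *m P^T.
  apply/matrixP => x y; rewrite !mxE !ord1 eqxx mulr1n.
  rewrite (bigD1 (mxvec_unindex y).2) //= big1 => [|c nc]; last first.
    by rewrite !mxE eq_sym (negPf nc) mulr0.
  rewrite !mxE eqxx mulr1 addr0 (bigD1 (mxvec_unindex x).2) //= big1 => [|c nc]; last first.
    by rewrite !mxE eq_sym (negPf nc) mul0r.
  by rewrite !mxE eqxx mul1r addr0.
by rewrite E det_mulmx_conj.
Qed.

Lemma det_flatten_scalar m (a : R) : \det (flatten_mx (a%:M : 'M_m)) = \det (rho a) ^+ m.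
Proof.
elim: m => [|m IHm]; first by rewrite det_mx00.
rewrite -[m.+1]/(1 + m)%N scalar_mx_block exprS -IHm -det_flatten_scalar1.
apply: (phi_block_diag (phi := fun r A => \det (flatten_mx A))).
  by move=> r A B; rewrite flatten_mxM det_mulmx.
exact: det_flatten_mxC.
Qed.

End Flatten.

(** * Finite fields inside their algebraic closure *)

(** The argument [incl] forces [L] to have the characteristic of [F], which is what makes the map
    additive. *)
Definition Frobenius (F : finFieldType) (L : fieldType) (incl : {rmorphism F -> L}) (x : L) : L :=
  x ^+ #|F|.

Lemma card_finField_pchar (F : finFieldType) (L : fieldType) :
  {rmorphism F -> L} -> [pchar L].-nat #|F|.
Proof.
move=> incl; have [p p_pr charFp] := finPcharP F.
by rewrite (card_pprimeChar charFp) pnatX pnatE ?(rmorph_pchar incl).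
Qed.

Section FrobeniusMorphism.

Variables (F : finFieldType) (L : fieldType) (incl : {rmorphism F -> L}).

Lemma Frobenius_zmod_morphism : zmod_morphism (Frobenius incl).
Proof.
move=> x y; rewrite /Frobenius exprDn_pchar ?exprNn_pchar //.
  exact: (card_finField_pchar incl).
exact: (card_finField_pchar incl).
Qed.

Lemma Frobenius_monoid_morphism : monoid_morphism (Frobenius incl).
Proof. by split=> [|x y]; rewrite /Frobenius ?expr1n ?exprMn. Qed.

HB.instance Definition _ := GRing.isZmodMorphism.Build L L (Frobenius incl)
  Frobenius_zmod_morphism.
HB.instance Definition _ := GRing.isMonoidMorphism.Build L L (Frobenius incl)
  Frobenius_monoid_morphism.

Local Notation q := #|F|.
Local Notation frob := (Frobenius incl).

Lemma card_finField_gt1 : (1 < q)%N.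
Proof. exact: finNzRing_gt1. Qed.

Lemma card_finField_L0 : q%:R = 0 :> L.
Proof.
rewrite -(rmorph_nat incl) -[RHS](rmorph0 incl); congr (incl _).
have [p p_pr charFp] := finPcharP F; apply/eqP.
have [e qe] : exists e, #|F| = (p ^ e)%N by eexists; exact: card_pprimeChar charFp.
rewrite qe natrX expf_eq0 (pcharf0 charFp) eqxx andbT.
by have := card_finField_gt1; rewrite qe; case: (e).
Qed.

Lemma Frobenius_incl a : frob (incl a) = incl a.
Proof. by rewrite /Frobenius -rmorphXn expf_card. Qed.

Lemma iter_Frobenius r x : iter r frob x = x ^+ (q ^ r).
Proof.
by elim: r => [|r IHr]; rewrite // iterS IHr /Frobenius -exprM -expnSr.
Qed.

(** The elements of [F] already account for all the roots of [X^q - X], which is the product of the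
    [X - a] over [F]. *)
Lemma Frobenius_fixed x : x ^+ q = x -> exists a, x = incl a.
Proof.
move=> xq; have : root (map_poly incl ('X^q - 'X)) x.
  by rewrite rmorphB /= map_polyXn map_polyX rootE !hornerE xq subrr.
rewrite finField_genPoly rmorph_prod rootE horner_prod => /prodf_eq0[a _].
by rewrite rmorphB /= map_polyX map_polyC hornerXsubC subr_eq0 => /eqP; exists a.
Qed.

Lemma horner_Frobenius (h : {poly F}) x :
  (map_poly incl h).[x ^+ q] = (map_poly incl h).[x] ^+ q.
Proof.
rewrite -!/(frob _) -horner_map /= -map_poly_comp; congr _.[_].
by apply: eq_map_poly => a /=; rewrite Frobenius_incl.
Qed.

Lemma horner_iter_Frobenius (h : {poly F}) x i :
  (map_poly incl h).[x ^+ (q ^ i)] = (map_poly incl h).[x] ^+ (q ^ i).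
Proof.
elim: i x => [|i IHi] x; first by rewrite !expr1.
by rewrite !expnSr !exprM horner_Frobenius IHi.
Qed.

(** Every [x ^+ (q ^ i)] is the value at [x] of a remainder modulo [p], and there are finitely many
    remainders. A collision gives a period after cancelling the injective Frobenius map. *)
Lemma integral_Frobenius_period x : integralOver incl x ->
  exists2 r, (0 < r)%N & x ^+ (q ^ r) = x.
Proof.
case=> p p_mon px0; have p0 := monic_neq0 p_mon.
pose d := (size p).-1.
pose h i : 'rV[F]_d := poly_rV ('X^(q ^ i) %% p).
have hx i : (map_poly incl (rVpoly (h i))).[x] = x ^+ (q ^ i).
  rewrite /h poly_rV_K; last first.
    by rewrite -ltnS prednK ?ltn_modp // size_poly_gt0.
  rewrite -[RHS]hornerXn -(map_polyXn incl) [in RHS](divp_eq 'X^(q ^ i) p).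
  by rewrite rmorphD rmorphM /= hornerD hornerM (eqP px0) mulr0 add0r.
have [m [j [lt_mj _ Eh]]] := nat_collision h.
have [r r_gt0 Dj] : exists2 r, (0 < r)%N & j = (r + m)%N.
  by exists (j - m)%N; rewrite ?subn_gt0 // subnK // ltnW.
have := hx j; rewrite -Eh hx Dj => /esym {hx Eh Dj lt_mj}.
rewrite expnD exprM -!iter_Frobenius => E; exists r => //; rewrite -iter_Frobenius.
by elim: m E => //= m IHm /fmorph_inj.
Qed.

Lemma Frobenius_period_dvd (x : L) r s : x ^+ (q ^ r) = x -> (r %| s)%N -> x ^+ (q ^ s) = x.
Proof.
move=> xr /dvdnP[m ->]; elim: m => [|m IHm]; first by rewrite expr1.
by rewrite mulSn expnD exprM xr.
Qed.

End FrobeniusMorphism.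

(** The polynomial [X^n - 1] with [n = q^R - 1] is separable because [n = -1] in [L], so its roots
    number [n] and include a primitive one. *)
Lemma Frobenius_prim_root (F : finFieldType) (L : closedFieldType) (incl : {rmorphism F -> L}) R :
  (0 < R)%N -> {z : L | (#|F| ^ R).-1.-primitive_root z}.
Proof.
move=> R_gt0; set n := (#|F| ^ R).-1.
have n_gt0 : (0 < n)%N.
  rewrite -ltnS prednK ?expn_gt0 ?(ltnW (card_finField_gt1 F)) //.
  by rewrite -[1%N](expn0 #|F|) ltn_exp2l // card_finField_gt1.
have n1 : n%:R = - 1 :> L.
  apply/eqP; rewrite -subr_eq0 opprK -mulrSr prednK ?expn_gt0 ?(ltnW (card_finField_gt1 F)) //.
  by rewrite natrX (card_finField_L0 incl) expr0n; case: (R) R_gt0.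
pose p : {poly L} := 'X^n - 1; have [r Dp] := closed_field_poly_normal p.
apply/sigW; rewrite (monicP _) ?monicXnsubC // scale1r in Dp.
have rn1: all n.-unity_root r by apply/allP=> z; rewrite -root_prod_XsubC -Dp.
have sz_r: (n < (size r).+1)%N.
  by rewrite -(size_prod_XsubC r id) -Dp size_XnsubC.
have [|z] := hasP (has_prim_root n_gt0 rn1 _ sz_r); last by exists z.
by rewrite -separable_prod_XsubC -Dp cyclotomic.separable_Xn_sub_1 // n1 oppr_eq0 oner_eq0.
Qed.

(* [C] is the matrix of the multiplication by [z] in the field [F(z)], and
   [\det C] is the norm of [z]. *)
Lemma Frobenius_companion (F : finFieldType) (L : fieldType) (incl : {rmorphism F -> L})
    R (z : L) : (#|F| ^ R.+1).-1.-primitive_root z ->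
  exists C : 'M[F]_R.+1,
    (forall h, root (map_poly incl h) z -> horner_mx C h = 0) /\
    (forall x, x != 0 -> exists k, x = \det C ^+ k).
Proof.
set q := #|F|; set n := _.-1 => prim_z.
have q_gt1 : (1 < q)%N := card_finField_gt1 F.
have qX_gt0 i : (0 < q ^ i)%N by rewrite expn_gt0 ltnW.
have zn : z ^+ n = 1 := prim_expr_order prim_z.
have z0 : z != 0.
  by apply: contra_eq_neq zn => ->; rewrite expr0n (gtn_eqF (prim_order_gt0 prim_z)) eq_sym oner_eq0.
have zQ : z ^+ (q ^ R.+1) = z by rewrite -(prednK (qX_gt0 _)) exprS zn mulr1.
pose rs := [seq z ^+ (q ^ i) | i : 'I_R.+1].
pose P := \prod_(i < R.+1) ('X - (z ^+ (q ^ i))%:P).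
have P_rs : P = \prod_(y <- rs) ('X - y%:P) by rewrite /P big_image.
(* The Frobenius map permutes the factors of [P] cyclically, as [z ^+ (q ^ R.+1) = z]; hence [P] has
   its coefficients in [F]. *)
have frobP : map_poly (Frobenius incl) P = P.
  rewrite rmorph_prod /P big_ord_recr [RHS]big_ord_recl mulrC /=.
  congr (_ * _); last first.
    by rewrite rmorphB /= map_polyX map_polyC /= /Frobenius -exprM -expnSr zQ expr1.
  apply: eq_bigr => i _.
  by rewrite rmorphB /= map_polyX map_polyC /= /Frobenius -exprM -expnSr.
have [p Dp] : exists p, map_poly incl p = P.
  have c i : {a | incl a == P`_i}.
    apply: sigW; have [|a ->] := @Frobenius_fixed F L incl P`_i; last by exists a.
    by rewrite -[in RHS]frobP coef_map.
  exists (\poly_(i < size P) sval (c i)); apply/polyP => i.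
  rewrite coef_map coef_poly; case: ltnP => [_|le]; first exact/eqP/(svalP (c i)).
  by rewrite nth_default // raddf0.
have P_mon : P \is monic by rewrite P_rs monic_prod_XsubC.
have p_mon : p \is monic by rewrite -(map_monic incl) Dp.
have sz_p : (size p).-1 = R.+1.
  rewrite -(size_map_poly incl) Dp P_rs size_prod_XsubC size_image card_ord.
  by [].
have [C DC] : exists C : 'M[F]_R.+1, char_poly C = p.
  by move: (companionmx p) (companionmxK p_mon); rewrite sz_p => C; exists C.
exists C; split=> [h hz|x x0].
  suff /dvdpP[g ->] : p %| h by rewrite rmorphM /= -DC Cayley_Hamilton mulr0.
  rewrite -(dvdp_map incl) Dp P_rs uniq_roots_dvdp //.
    apply/allP => _ /fintype.imageP[i _ ->].
    by rewrite rootE horner_iter_Frobenius (eqP hz) expr0n eqn0Ngt qX_gt0.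
  rewrite uniq_rootsE map_inj_in_uniq ?enum_uniq // => i j _ _ /eqP.
  rewrite (eq_prim_root_expr prim_z).
  (* The exponents are compared after subtracting 1, because [q ^ k < n] itself fails for [q = 2]
     and [R = 0]. *)
  have lt_n (k : 'I_R.+1) : ((q ^ k).-1 < n)%N.
    by rewrite /n -ltnS !prednK // ltn_exp2l.
  have inj_n a b : (a < n)%N -> (b < n)%N -> a.+1 == b.+1 %[mod n] -> a = b.
    by move=> an bn; rewrite -[a.+1]addn1 -[b.+1]addn1 eqn_modDr !modn_small // => /eqP.
  rewrite -(prednK (qX_gt0 i)) -(prednK (qX_gt0 j)) => /inj_n E.
  apply/val_inj/eqP; rewrite -(eqn_exp2l _ _ q_gt1).
  by rewrite -(prednK (qX_gt0 i)) -(prednK (qX_gt0 j)) E.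
(* The norm of [z] is [z ^+ c]. As [n = (q - 1) * c], a power [z ^+ i] that is killed by [q - 1] has
   [c] dividing [i], so the norm generates the nonzero elements of [F]. *)
pose c := (\sum_(i < R.+1) q ^ i)%N.
have nc : n = (q.-1 * c)%N by rewrite /n predn_exp.
have detC : incl (\det C) = z ^+ c.
  have := char_poly_det C; rewrite DC => /(congr1 incl).
  rewrite -coef_map Dp rmorphM rmorphXn rmorphN1 -horner_coef0 horner_prod.
  under eq_bigr do rewrite hornerXsubC add0r.
  by rewrite prodrN card_ord -expr_sum => /mulrI <- //; rewrite unitrX // unitrN1.
have xq : incl x ^+ q.-1 = 1.
  rewrite -rmorphXn; apply/eqP; rewrite fmorph_eq1.
  by rewrite -(inj_eq (mulfI x0)) mulr1 -exprS prednK ?expf_card // ltnW.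
have [i Dx] : exists i : nat, incl x = z ^+ i.
  by have [|i ->] := prim_rootP prim_z (x := incl x); [rewrite nc exprM xq expr1n | exists i].
have : (c %| i)%N.
  move: xq => /eqP; rewrite Dx -exprM -(prim_order_dvd prim_z) nc mulnC.
  by rewrite dvdn_pmul2r // -ltnS prednK // ltnW.
case/dvdnP => k Di; exists k; apply: (fmorph_inj incl).
by rewrite rmorphXn detC Dx Di mulnC exprM.
Qed.

(** * Direct summands of representations *)

(** In the rank factorization [e = col_base e *m row_base e], cancel the outer factors of
    [e *m e = e]. *)
Lemma row_base_idem (K : fieldType) n (e : 'M[K]_n) :
  e *m e = e -> row_base e *m col_base e = 1%:M.
Proof.
move=> ee; have E : (col_base e *m row_base e) *m (col_base e *m row_base e)
    = col_base e *m row_base e by rewrite mulmx_base.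
apply: (row_free_inj (row_base_free e)); rewrite mul1mx.
by apply: (row_full_inj (col_base_full e)); rewrite -[RHS]E !mulmxA.
Qed.

Section Retracts.

Variables (K : fieldType) (Q : quiver).

Definition rep_hom (b c : dimvec Q) (X : rep K b) (Y : rep K c)
    (f : forall v, 'M[K]_(b v, c v)) : Prop :=
  forall a, X a *m f (target a) = f (source a) *m Y a.

(** A direct summand without mention of its complement: the notion composes, and any idempotent
    endomorphism produces one. *)
Definition rep_retract (b c : dimvec Q) (X : rep K b) (Y : rep K c) : Prop :=
  exists (A : forall v, 'M[K]_(b v, c v)) (B : forall v, 'M[K]_(c v, b v)),
    [/\ rep_hom X Y A, rep_hom Y X B & forall v, B v *m A v = 1%:M].

Lemma rep_retract_refl (b : dimvec Q) (X : rep K b) : rep_retract X X.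
Proof.
exists (fun v => 1%:M), (fun v => 1%:M); split=> [a|a|v]; rewrite ?mulmx1 //.
  by rewrite mul1mx.
by rewrite mul1mx.
Qed.

Lemma rep_retract_trans (b c e : dimvec Q) (X : rep K b) (Y : rep K c) (Z : rep K e) :
  rep_retract X Y -> rep_retract Y Z -> rep_retract X Z.
Proof.
case=> A [B [hA hB BA]] [C [D [hC hD DC]]].
exists (fun v => A v *m C v), (fun v => D v *m B v); split=> [a|a|v].
- by rewrite mulmxA hA -mulmxA hC mulmxA.
- by rewrite mulmxA hD -mulmxA hB mulmxA.
- by rewrite mulmxA -(mulmxA (D v)) BA mulmx1 DC.
Qed.

Lemma rep_retract_dim (b c : dimvec Q) (X : rep K b) (Y : rep K c) v :
  rep_retract X Y -> (c v <= b v)%N.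
Proof. by case=> A [B [_ _ /(_ v)/mulmx1_min]]. Qed.

Lemma rep_iso_retractl (b c e : dimvec Q) (X : rep K b) (Y : rep K c) (Z : rep K e) :
  rep_iso X (rep_sum Y Z) -> rep_retract X Y.
Proof.
case=> f [f' [ff' f'f hf]].
have hf' a : rep_sum Y Z a *m f' (target a) = f' (source a) *m X a.
  rewrite -[LHS]mul1mx -f'f -!mulmxA; congr (_ *m _).
  by rewrite mulmxA -hf -mulmxA ff' mulmx1.
exists (fun v => f v *m col_mx 1%:M 0), (fun v => row_mx 1%:M 0 *m f' v).
split=> [a|a|v].
- rewrite mulmxA hf -!mulmxA ffunE; congr (_ *m _).
  by rewrite mul_block_col mul_col_mx !mulmx1 !mulmx0 mul1mx mul0mx !addr0.
- rewrite -mulmxA -hf' !mulmxA ffunE; congr (_ *m _).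
  by rewrite mul_row_block mul_mx_row !mul1mx !mul0mx mulmx1 mulmx0 !addr0.
- by rewrite mulmxA -(mulmxA _ (f' v)) f'f mulmx1 mul_row_col mulmx1 mulmx0 addr0.
Qed.

Lemma rep_iso_retractr (b c e : dimvec Q) (X : rep K b) (Y : rep K c) (Z : rep K e) :
  rep_iso X (rep_sum Y Z) -> rep_retract X Z.
Proof.
case=> f [f' [ff' f'f hf]].
have hf' a : rep_sum Y Z a *m f' (target a) = f' (source a) *m X a.
  rewrite -[LHS]mul1mx -f'f -!mulmxA; congr (_ *m _).
  by rewrite mulmxA -hf -mulmxA ff' mulmx1.
exists (fun v => f v *m col_mx 0 1%:M), (fun v => row_mx 0 1%:M *m f' v).
split=> [a|a|v].
- rewrite mulmxA hf -!mulmxA ffunE; congr (_ *m _).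
  by rewrite mul_block_col mul_col_mx !mulmx1 !mulmx0 mul1mx mul0mx !add0r.
- rewrite -mulmxA -hf' !mulmxA ffunE; congr (_ *m _).
  by rewrite mul_row_block mul_mx_row !mul1mx !mul0mx mulmx1 mulmx0 !add0r.
- by rewrite mulmxA -(mulmxA _ (f' v)) f'f mulmx1 mul_row_col mulmx1 mulmx0 add0r.
Qed.

Lemma rep_idem_retract (b : dimvec Q) (X : rep K b) (e : forall v, 'M[K]_(b v)) :
    rep_hom X X e -> (forall v, e v *m e v = e v) ->
  exists (Y : rep K (fun v => \rank (e v)))
      (A : forall v, 'M[K]_(b v, \rank (e v))) (B : forall v, 'M[K]_(\rank (e v), b v)),
    [/\ rep_hom X Y A, rep_hom Y X B, forall v, B v *m A v = 1%:M &
        forall v, A v *m B v = e v].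
Proof.
move=> he ee.
have [A [B [AB BA]]] : exists (A : forall v, 'M[K]_(b v, \rank (e v)))
    (B : forall v, 'M[K]_(\rank (e v), b v)),
    (forall v, A v *m B v = e v) /\ (forall v, B v *m A v = 1%:M).
  exists (fun v => col_base (e v)), (fun v => row_base (e v)).
  by split=> v; [apply: mulmx_base | apply: row_base_idem].
have eA v : e v *m A v = A v by rewrite -[X in X *m _]AB -mulmxA BA mulmx1.
have Be v : B v *m e v = B v by rewrite -[X in _ *m X]AB mulmxA BA mul1mx.
exists [ffun a : arrow Q => B (source a) *m X a *m A (target a)], A, B.
split=> // a; rewrite ffunE.
  by rewrite !mulmxA AB -he -mulmxA eA.
by rewrite -!mulmxA AB he mulmxA Be.
Qed.

(** The complement is the image of the idempotent [1 - A B]. *)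
Lemma rep_retract_sum (b c : dimvec Q) (X : rep K b) (Y : rep K c) :
  rep_retract X Y -> exists (e : dimvec Q) (Z : rep K e), rep_iso X (rep_sum Y Z).
Proof.
case=> A [B [hA hB BA]].
have [||Z [C [D [hC hD DC CD]]]] :=
  @rep_idem_retract b X (fun v => 1%:M - A v *m B v).
- by move=> a; rewrite mulmxBr mulmxBl mulmx1 mul1mx mulmxA hA -!mulmxA hB.
- move=> v; rewrite mulmxBr mulmx1 mulmxBl mul1mx -mulmxA (mulmxA (B v)) BA mul1mx.
  by rewrite subrr subr0.
exists (fun v => \rank (1%:M - A v *m B v)), Z.
exists (fun v => row_mx (A v) (C v)), (fun v => col_mx (B v) (D v)).
split=> [v|v|a].
- by rewrite mul_row_col CD addrC subrK.
- rewrite mul_col_row BA DC scalar_mx_block; congr block_mx.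
    rewrite -[LHS]mulmx1 -DC mulmxA -(mulmxA _ (C v)) CD mulmxBr mulmx1 mulmxA BA mul1mx.
    by rewrite subrr mul0mx.
  rewrite -[LHS]mul1mx -DC -mulmxA (mulmxA (C v)) CD mulmxBl mul1mx -(mulmxA (A v)) BA mulmx1.
  by rewrite subrr mulmx0.
- by rewrite ffunE mul_mx_row hA hC mul_row_block !mulmx0 addr0 add0r.
Qed.

Lemma indec_dimsP (b : dimvec Q) (X : rep K b) c :
  indec_dims X c <-> exists Y : rep K c, indecomposable Y /\ rep_retract X Y.
Proof.
split=> [[e [Y [Z [indY isoX]]]] | [Y [indY /rep_retract_sum[e [Z isoX]]]]].
  by exists Y; split=> //; apply: rep_iso_retractl isoX.
by exists e, Y, Z.
Qed.

(** By induction on the total dimension, one of two summands inherits [p]. In the applications [p]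
    is the failure of an additive condition: being zero, or having trivial character at a given
    scalar. *)
Lemma indecomposable_retract (p : dimvec Q -> Prop) :
    (forall c, p c -> ~ dim_zero c) ->
    (forall c e, p (dim_add c e) -> p c \/ p e) ->
  forall (b : dimvec Q) (X : rep K b), p b ->
  exists (c : dimvec Q) (Y : rep K c), [/\ indecomposable Y, rep_retract X Y & p c].
Proof.
move=> p0 pD b X; have [m] := ubnP (\sum_v b v)%N.
elim: m b X => // m IHm b X; rewrite ltnS => le_m pb.
have [indX|] := pselect (indecomposable X).
  by exists b, X; split=> //; apply: rep_retract_refl.
case/not_andP => [/(_ (p0 b pb)) //|/existsNP[c /existsNP[e /existsNP[Y /existsNP[Z]]]]].
case/not_implyP => isoX /not_orP[c0 e0].
have Db : b = dim_add c e.
  apply: funext => v; case: isoX => f [f' [/(_ v)/mulmx1_min le1 /(_ v)/mulmx1_min le2 _]].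
  by apply/eqP; rewrite eqn_leq le1.
have sum_gt0 (d : dimvec Q) : ~ dim_zero d -> (0 < \sum_v d v)%N.
  move=> d0; rewrite lt0n; apply/negP; rewrite sum_nat_eq0 => /forallP d0'.
  by apply: d0 => v; apply/eqP/d0'.
have sumb : (\sum_v b v = \sum_v c v + \sum_v e v)%N by rewrite -big_split Db.
case: (pD c e); first by rewrite -Db.
- move=> pc; have [|c' [Y' [indY' YY' pc']]] := IHm c Y _ pc.
    by apply: leq_trans le_m; rewrite sumb -[X in (X < _)%N]addn0 ltn_add2l sum_gt0.
  exists c', Y'; split=> //; apply: rep_retract_trans YY'.
  exact: rep_iso_retractl isoX.
- move=> pe; have [|c' [Y' [indY' YY' pc']]] := IHm e Z _ pe.
    by apply: leq_trans le_m; rewrite sumb -[X in (X < _)%N]add0n ltn_add2r sum_gt0.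
  exists c', Y'; split=> //; apply: rep_retract_trans YY'.
  exact: rep_iso_retractr isoX.
Qed.

End Retracts.

(** * The endomorphism ring of a representation *)

Section EndomorphismRing.

Variables (F : finFieldType) (Q : quiver) (b : dimvec Q) (X : rep F b).

(** A subtype of finite functions, so as to be a finite ring as the stable range argument demands.
    The zero representation has the zero ring, whence the structure [PzRing]. *)
Record rep_end := RepEnd {
  rep_end_val :> {dffun forall v : vertex Q, 'M[F]_(b v)};
  rep_endP : [forall a, X a *m rep_end_val (target a) == rep_end_val (source a) *m X a] }.

HB.instance Definition _ := [isSub for rep_end_val].
HB.instance Definition _ := [Finite of rep_end by <:].

Lemma rep_end_hom (f : rep_end) : rep_hom X X f.
Proof. by move=> a; apply/eqP; have /forallP := rep_endP f. Qed.

Definition rep_end_of (f : forall v, 'M[F]_(b v)) (hf : rep_hom X X f) : rep_end.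
Proof.
exists [ffun v : vertex Q => f v]; apply/forallP => a; rewrite !ffunE; apply/eqP; exact: hf.
Defined.

Lemma rep_end_ofE f hf v : @rep_end_of f hf v = f v.
Proof. by rewrite ffunE. Qed.

Lemma rep_end_inj (f g : rep_end) : (forall v, f v = g v) -> f = g.
Proof. by move=> E; apply: val_inj; apply/ffunP. Qed.

Lemma rep_hom0 : rep_hom X X (fun v => 0).
Proof. by move=> a; rewrite mulmx0 mul0mx. Qed.
Lemma rep_hom1 : rep_hom X X (fun v => 1%:M).
Proof. by move=> a; rewrite mulmx1 mul1mx. Qed.
Lemma rep_homN (f : rep_end) : rep_hom X X (fun v => - f v).
Proof. by move=> a; rewrite mulmxN mulNmx rep_end_hom. Qed.
Lemma rep_homD (f g : rep_end) : rep_hom X X (fun v => f v + g v).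
Proof. by move=> a; rewrite mulmxDr mulmxDl !rep_end_hom. Qed.
Lemma rep_homM (f g : rep_end) : rep_hom X X (fun v => f v *m g v).
Proof. by move=> a; rewrite mulmxA rep_end_hom -!mulmxA rep_end_hom. Qed.

Definition rep_end0 := rep_end_of rep_hom0.
Definition rep_end1 := rep_end_of rep_hom1.
Definition rep_endN f := rep_end_of (rep_homN f).
Definition rep_endD f g := rep_end_of (rep_homD f g).
Definition rep_endM f g := rep_end_of (rep_homM f g).

Lemma rep_endDA : associative rep_endD.
Proof. by move=> f g h; apply: rep_end_inj => v; rewrite !rep_end_ofE addrA. Qed.
Lemma rep_endDC : commutative rep_endD.
Proof. by move=> f g; apply: rep_end_inj => v; rewrite !rep_end_ofE addrC. Qed.
Lemma rep_end0D : left_id rep_end0 rep_endD.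
Proof. by move=> f; apply: rep_end_inj => v; rewrite !rep_end_ofE add0r. Qed.
Lemma rep_endND : left_inverse rep_end0 rep_endN rep_endD.
Proof. by move=> f; apply: rep_end_inj => v; rewrite !rep_end_ofE addNr. Qed.

HB.instance Definition _ :=
  GRing.isZmodule.Build rep_end rep_endDA rep_endDC rep_end0D rep_endND.

Lemma rep_endMA : associative rep_endM.
Proof. by move=> f g h; apply: rep_end_inj => v; rewrite !rep_end_ofE mulmxA. Qed.
Lemma rep_end1M : left_id rep_end1 rep_endM.
Proof. by move=> f; apply: rep_end_inj => v; rewrite !rep_end_ofE mul1mx. Qed.
Lemma rep_endM1 : right_id rep_end1 rep_endM.
Proof. by move=> f; apply: rep_end_inj => v; rewrite !rep_end_ofE mulmx1. Qed.
Lemma rep_endMDl : left_distributive rep_endM rep_endD.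
Proof. by move=> f g h; apply: rep_end_inj => v; rewrite !rep_end_ofE mulmxDl. Qed.
Lemma rep_endMDr : right_distributive rep_endM rep_endD.
Proof. by move=> f g h; apply: rep_end_inj => v; rewrite !rep_end_ofE mulmxDr. Qed.

HB.instance Definition _ := GRing.Zmodule_isPzRing.Build rep_end
  rep_endMA rep_end1M rep_endM1 rep_endMDl rep_endMDr.

Definition rep_end_at (v : vertex Q) (f : rep_end) : 'M[F]_(b v) := f v.

Lemma rep_end_at_zmod_morphism v : zmod_morphism (rep_end_at v).
Proof. by move=> f g; rewrite /rep_end_at !rep_end_ofE. Qed.
Lemma rep_end_at_monoid_morphism v : monoid_morphism (rep_end_at v).
Proof. by split=> [|f g]; rewrite /rep_end_at !rep_end_ofE. Qed.

HB.instance Definition _ v := GRing.isZmodMorphism.Build rep_end 'M[F]_(b v) (rep_end_at v)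
  (rep_end_at_zmod_morphism v).
HB.instance Definition _ v := GRing.isMonoidMorphism.Build rep_end 'M[F]_(b v) (rep_end_at v)
  (rep_end_at_monoid_morphism v).

End EndomorphismRing.

(** * From automorphisms to dimension vectors of geometric summands *)

Section TrivialCharacter.

Variables (F : finFieldType) (Q : quiver) (T : comPzRingType).
Variable tau : vertex Q -> F -> T.
Hypothesis tauM : forall v, {morph tau v : x y / x * y}.
Hypothesis tau1 : forall v, tau v 1 = 1.

Definition aut_trivial (b : dimvec Q) (X : rep F b) : Prop :=
  forall f f' : forall v, 'M[F]_(b v), rep_hom X X f ->
    (forall v, f v *m f' v = 1%:M) -> \prod_v tau v (\det (f v)) = 1.

Definition dim_trivial (c : dimvec Q) : Prop :=
  forall x, x != 0 -> \prod_v tau v x ^+ c v = 1.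

Lemma tauX v x m : tau v (x ^+ m) = tau v x ^+ m.
Proof. by elim: m => [|m IHm]; rewrite ?tau1 // !exprS tauM IHm. Qed.

Lemma GL_aut_trivial (b : dimvec Q) (X : rep F b) r (U U' : 'M[rep_end X]_r) :
    aut_trivial X -> U *m U' = 1%:M -> U' *m U = 1%:M ->
  \prod_v tau v (\det (flatten_mx (rep_end_at v) U)) = 1.
Proof.
move=> trX; apply: (@K1_trivial (rep_end X) T
  (fun r U => \prod_v tau v (\det (flatten_mx (rep_end_at v) U)))).
- move=> s A B; rewrite -big_split; apply: eq_bigr => v _.
  by rewrite flatten_mxM det_mulmx tauM.
- by move=> s t A B; apply: eq_bigr => v _; rewrite det_flatten_mxC.
- move=> f f' ff' _; under eq_bigr do rewrite det_flatten_scalar1.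
  apply: (trX _ (fun v => rep_end_at v f')); first exact: rep_end_hom.
  by move=> v; rewrite -[LHS]/(rep_end_at v f * rep_end_at v f') -rmorphM ff' rmorph1.
Qed.

Section Closure.

Variable (L : closedFieldType) (incl : {rmorphism F -> L}).
Hypothesis incl_int : integralRange incl.

Definition rep_map (b : dimvec Q) (X : rep F b) : rep L b :=
  [ffun a : arrow Q => map_mx incl (X a)].

(** All the entries lie in one finite extension of [F]: the product of their Frobenius periods is a
    common one. *)
Lemma common_Frobenius_period (b c : dimvec Q) (A : forall v, 'M[L]_(b v, c v)) :
  exists R, forall v i j, A v i j ^+ (#|F| ^ R.+1) = A v i j.
Proof.
have per (y : L) : {r | (0 < r)%N && (y ^+ (#|F| ^ r) == y)}.
  apply: sigW; have [r r0 /eqP yr] := integral_Frobenius_period (incl_int y).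
  by exists r; rewrite r0.
pose R := (\prod_v \prod_i \prod_j sval (per (A v i j)))%N.
have R0 : (0 < R)%N.
  rewrite !prodn_gt0 // => v; rewrite prodn_gt0 // => i; rewrite prodn_gt0 // => j.
  by case/andP: (svalP (per (A v i j))).
exists R.-1 => v i j; rewrite prednK //.
have /andP[_ /eqP] := svalP (per (A v i j)).
move/Frobenius_period_dvd; apply.
rewrite /R (bigD1 v) //= dvdn_mulr // (bigD1 i) //= dvdn_mulr // (bigD1 j) //=.
exact: dvdn_mulr.
Qed.

Section Lift.

Variables (R : nat) (z : L).
Hypothesis prim_z : (#|F| ^ R.+1).-1.-primitive_root z.
Variable C : 'M[F]_R.+1.
Hypothesis kerC : forall h, root (map_poly incl h) z -> horner_mx C h = 0.

(** Polynomials stand for elements of [F(z)]; by [kerC], what is computed by substituting [C]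
    depends only on the value at [z]. *)
Definition eval_at : {poly F} -> L := horner_eval z \o map_poly incl.
HB.instance Definition _ := GRing.RMorphism.on eval_at.

Lemma eval_atC a : eval_at a%:P = incl a.
Proof. by rewrite /eval_at /= map_polyC /horner_eval hornerC. Qed.

Lemma eval_atX : eval_at 'X = z.
Proof. by rewrite /eval_at /= map_polyX /horner_eval hornerX. Qed.

(** A nonzero such [y] is a root of unity of order dividing that of [z], hence a power of [z]. *)
Lemma eval_at_lift y : y ^+ (#|F| ^ R.+1) = y -> exists h, eval_at h = y.
Proof.
move=> yQ; have [-> |y0] := eqVneq y 0; first by exists 0; rewrite rmorph0.
have [|i ->] := prim_rootP prim_z (x := y).
  apply: (mulfI y0); rewrite -exprS prednK ?mulr1 ?yQ //.
  by rewrite expn_gt0 ltnW ?card_finField_gt1.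
by exists 'X^i; rewrite rmorphXn /= eval_atX.
Qed.

Lemma eval_mx_lift m n (A : 'M[L]_(m, n)) :
    (forall i j, A i j ^+ (#|F| ^ R.+1) = A i j) ->
  {S : 'M[{poly F}]_(m, n) | map_mx eval_at S = A}.
Proof.
move=> AQ; have lift i j : {h | eval_at h == A i j}.
  by apply: sigW; have [h <-] := eval_at_lift (AQ i j); exists h.
exists (\matrix_(i, j) sval (lift i j)); apply/matrixP => i j.
by rewrite !mxE (eqP (svalP (lift i j))).
Qed.

Lemma horner_mx_eval h h' : eval_at h = eval_at h' -> horner_mx C h = horner_mx C h'.
Proof.
move=> E; apply/eqP; rewrite -subr_eq0 -rmorphB; apply/eqP/kerC.
by apply/eqP; rewrite -[LHS]/(eval_at _) rmorphB /= E subrr.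
Qed.

Lemma flatten_mx_eval m n (S S' : 'M[{poly F}]_(m, n)) :
  map_mx eval_at S = map_mx eval_at S' ->
  flatten_mx (horner_mx C) S = flatten_mx (horner_mx C) S'.
Proof.
move/matrixP => E; apply/matrixP => x y; rewrite !mxE; congr (fun_of_matrix _ _ _).
by apply: horner_mx_eval; have := E (mxvec_unindex x).1 (mxvec_unindex y).1; rewrite !mxE.
Qed.

(* The (i, j) block of the restriction of scalars from [F(z)] to [F] of a matrix with
   entries in [F(z)], represented by polynomials in [z]. *)
Definition scalar_block m n (i j : 'I_R.+1) (S : 'M[{poly F}]_(m, n)) : 'M[F]_(m, n) :=
  map_mx (fun h => horner_mx C h i j) S.

Lemma scalar_block_eval m n i j (S S' : 'M[{poly F}]_(m, n)) :
  map_mx eval_at S = map_mx eval_at S' -> scalar_block i j S = scalar_block i j S'.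
Proof.
move/matrixP => E; apply/matrixP => x y; rewrite !mxE; congr (fun_of_matrix _ _ _).
by apply: horner_mx_eval; have := E x y; rewrite !mxE.
Qed.

Lemma scalar_blockM m n p i k (S : 'M[{poly F}]_(m, n)) (S' : 'M_(n, p)) :
  scalar_block i k (S *m S') = \sum_j scalar_block i j S *m scalar_block j k S'.
Proof.
apply/matrixP => x y; rewrite !mxE summxE rmorph_sum summxE.
under [RHS]eq_bigr do rewrite mxE.
rewrite exchange_big /=; apply: eq_bigr => t _.
by rewrite rmorphM mxE; apply: eq_bigr => j _; rewrite !mxE.
Qed.

Lemma scalar_block_mull m n p i j (A : 'M[F]_(m, n)) (S : 'M[{poly F}]_(n, p)) :
  A *m scalar_block i j S = scalar_block i j (map_mx polyC A *m S).
Proof.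
apply/matrixP => x y; rewrite !mxE rmorph_sum summxE; apply: eq_bigr => t _.
by rewrite !mxE mul_polyC /= horner_mxZ mxE.
Qed.

Lemma scalar_block_mulr m n p i j (A : 'M[F]_(n, p)) (S : 'M[{poly F}]_(m, n)) :
  scalar_block i j S *m A = scalar_block i j (S *m map_mx polyC A).
Proof.
apply/matrixP => x y; rewrite !mxE rmorph_sum summxE; apply: eq_bigr => t _.
by rewrite !mxE mulrC [S x t * _]mulrC mul_polyC /= horner_mxZ mxE.
Qed.

Variables (b : dimvec Q) (X : rep F b).

(** Commutation with [X] is known only for the values at [z], which is enough by
    [scalar_block_eval], since [X] has constant entries. *)
Lemma scalar_block_hom (S : forall v, 'M[{poly F}]_(b v)) i j :
    rep_hom (rep_map X) (rep_map X) (fun v => map_mx eval_at (S v)) ->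
  rep_hom X X (fun v => scalar_block i j (S v)).
Proof.
move=> hS a; rewrite scalar_block_mull scalar_block_mulr; apply: scalar_block_eval.
have inclE m n (A : 'M[F]_(m, n)) : map_mx eval_at (map_mx polyC A) = map_mx incl A.
  by apply/matrixP => x y; rewrite !mxE eval_atC.
by have := hS a; rewrite !ffunE !map_mxM !inclE.
Qed.

Definition restrict_mx (S : forall v, 'M[{poly F}]_(b v))
    (hS : rep_hom (rep_map X) (rep_map X) (fun v => map_mx eval_at (S v))) :
    'M[rep_end X]_R.+1 :=
  \matrix_(i, j) rep_end_of (scalar_block_hom i j hS).

Lemma restrict_mxM1 S S' hS hS' :
    (forall v, map_mx eval_at (S v) *m map_mx eval_at (S' v) = 1%:M) ->
  @restrict_mx S hS *m @restrict_mx S' hS' = 1%:M.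
Proof.
move=> SS'; apply/matrixP => i k; apply: rep_end_inj => v.
rewrite mxE -[LHS]/(rep_end_at v _) rmorph_sum.
transitivity (scalar_block i k (S v *m S' v)).
  rewrite scalar_blockM; apply: eq_bigr => j _.
  by rewrite rmorphM /= !mxE /rep_end_at !rep_end_ofE.
rewrite (@scalar_block_eval _ _ _ _ _ 1%:M) ?map_mxM ?SS' ?map_mx1 //.
rewrite mxE -[RHS]/(rep_end_at v _) rmorphMn rmorph1 /=.
apply/matrixP => x y; rewrite !mxE mulmxnE mxE.
case: (x == y); last by rewrite rmorph0 mxE mul0rn.
by rewrite rmorph1 mxE.
Qed.

(** One side has the basis of [F(z)] as outer index and the space at [v] as inner index, the other
    side the reverse. *)
Lemma det_restrict_mx S hS v :
  \det (flatten_mx (rep_end_at v) (@restrict_mx S hS)) =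
  \det (flatten_mx (horner_mx C) (S v)).
Proof.
apply: det_mxvec_swap => i j k l.
by rewrite !mxE !mxvec_indexK /= /rep_end_at rep_end_ofE mxE.
Qed.

Lemma retract_det_trivial (c : dimvec Q) (Y : rep L c)
    (SA : forall v, 'M[{poly F}]_(b v, c v)) (SB : forall v, 'M[{poly F}]_(c v, b v)) :
    aut_trivial X ->
    rep_hom (rep_map X) Y (fun v => map_mx eval_at (SA v)) ->
    rep_hom Y (rep_map X) (fun v => map_mx eval_at (SB v)) ->
    (forall v, map_mx eval_at (SB v) *m map_mx eval_at (SA v) = 1%:M) ->
  \prod_v tau v (\det C) ^+ c v = 1.
Proof.
move=> trX hA hB BA.
pose S (h : {poly F}) v := 1%:M + ((h - 1) *: SA v) *m SB v.
have evS h v : map_mx eval_at (S h v) =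
    1%:M + (eval_at h - 1) *: (map_mx eval_at (SA v) *m map_mx eval_at (SB v)).
  by rewrite map_mxD map_mx1 map_mxM map_mxZ rmorphB /= (rmorph1 eval_at) scalemxAl.
have hS h : rep_hom (rep_map X) (rep_map X) (fun v => map_mx eval_at (S h v)).
  move=> a; rewrite !evS mulmxDr mulmxDl mulmx1 mul1mx -scalemxAr -scalemxAl.
  by rewrite mulmxA hA -!mulmxA hB.
have SS h h' : eval_at h * eval_at h' = 1 -> forall v,
    map_mx eval_at (S h v) *m map_mx eval_at (S h' v) = 1%:M.
  move=> hh' v; rewrite !evS mulmxDr mulmx1 mulmxDl mul1mx -scalemxAl -scalemxAr.
  rewrite scalerA mulmxA -(mulmxA (map_mx _ _) (map_mx _ (SB v))) BA mulmx1.
  rewrite -addrA -!scalerDl [X in X *: _](_ : _ = eval_at h * eval_at h' - 1); last by ring.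
  by rewrite hh' subrr scale0r addr0.
have zn : z ^+ (#|F| ^ R.+1).-1 = 1 := prim_expr_order prim_z.
have n_gt0 := prim_order_gt0 prim_z.
(* The inverse of [z] is its power of exponent one less than its order. *)
have zz' : eval_at 'X * eval_at ('X^((#|F| ^ R.+1).-2)) = 1.
  by rewrite rmorphXn /= eval_atX -exprS prednK.
have z'z : eval_at ('X^((#|F| ^ R.+1).-2)) * eval_at 'X = 1 by rewrite mulrC.
have := GL_aut_trivial trX (restrict_mxM1 (hS 'X) (hS _) (SS _ _ zz'))
  (restrict_mxM1 (hS _) (hS 'X) (SS _ _ z'z)).
move=> E; rewrite -[RHS]E; apply: eq_bigr => v _; rewrite -tauX; congr (tau v _).
(* Sylvester's identity replaces [1 + (z - 1) A B] by [1 + (z - 1) B A], which is the scalar [z] in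
   size [c v] because [B A = 1]. *)
rewrite det_restrict_mx /S det_flatten_mxC.
rewrite (@flatten_mx_eval _ _ _ ('X%:M)).
  by rewrite det_flatten_scalar /= horner_mx_X.
rewrite map_mxD map_mx1 map_mxM map_mxZ -scalemxAr BA map_scalar_mx rmorphB /=.
by rewrite (rmorph1 eval_at) eval_atX scalemx1 -raddfD /= addrC subrK.
Qed.

End Lift.

(* If [A *m B] is the projector on the summand [Y], the automorphism [1 + (z - 1) A B] over
   [F(z)] restricts to an invertible matrix over End(X), on which the character is trivial
   by [GL_aut_trivial]; its determinant at [v] is the norm of [z] to the power [c v]. *)
Lemma aut_trivial_dim (b : dimvec Q) (X : rep F b) (c : dimvec Q) (Y : rep L c) :
  aut_trivial X -> rep_retract (rep_map X) Y -> dim_trivial c.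
Proof.
move=> trX [A [B [hA hB BA]]].
(* Stacking [A] with the transpose of [B] gives one exponent for both. *)
have [R perAB] := common_Frobenius_period (fun v => row_mx (A v) (B v)^T).
have [z prim_z] := Frobenius_prim_root incl (ltn0Sn R).
have [C [kerC genC]] := Frobenius_companion incl prim_z.
have liftA v : {S : 'M[{poly F}]_(b v, c v) | map_mx (eval_at z) S = A v}.
  apply: (eval_mx_lift prim_z) => i j.
  by have := perAB v i (lshift _ j); rewrite row_mxEl.
have liftB v : {S : 'M[{poly F}]_(c v, b v) | map_mx (eval_at z) S = B v}.
  apply: (eval_mx_lift prim_z) => i j.
  by have := perAB v j (rshift _ i); rewrite row_mxEr mxE.
have E : \prod_v tau v (\det C) ^+ c v = 1.
  apply: (retract_det_trivial prim_z kerC (Y := Y)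
    (SA := fun v => sval (liftA v)) (SB := fun v => sval (liftB v)) trX).
  - by move=> a; rewrite !(svalP (liftA _)).
  - by move=> a; rewrite !(svalP (liftB _)).
  - by move=> v; rewrite (svalP (liftA v)) (svalP (liftB v)).
move=> x /genC[k ->]; under eq_bigr do rewrite tauX exprAC.
by rewrite prodrXl E expr1n.
Qed.

End Closure.

End TrivialCharacter.

(** * From dimension vectors of geometric summands to automorphisms *)

Lemma sum_expr_unity (L : fieldType) n (y : L) : y ^+ n = 1 -> y != 1 -> \sum_(i < n) y ^+ i = 0.
Proof.
move=> yn y1; apply: (mulfI (x := y - 1)); first by rewrite subr_eq0.
by rewrite -subrX1 yn subrr mulr0.
Qed.

Section SpectralIdempotents.

Variables (L : fieldType) (n m : nat) (z : L) (G : 'M[L]_m).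
Hypothesis prim_z : n.-primitive_root z.
Hypothesis n_unit : n%:R != 0 :> L.
Hypothesis Gn : G ^+ n = 1.

(** The discrete Fourier transform of the powers of [G]: the projector on the eigenspace of [G] for
    the eigenvalue [z ^+ i]. *)
Definition spectral_idem (i : nat) : 'M[L]_m :=
  n%:R^-1 *: \sum_(k < n) z ^- (i * k) *: G ^+ k.

Local Notation e := spectral_idem.

Let n_gt0 : (0 < n)%N := prim_order_gt0 prim_z.
Let z0 : z != 0.
Proof.
apply: contra_eq_neq (prim_expr_order prim_z) => ->.
by rewrite expr0n (gtn_eqF n_gt0) eq_sym oner_eq0.
Qed.

Lemma mul_spectral_idem i : G *m e i = z ^+ i *: e i.
Proof.
rewrite /spectral_idem -scalemxAr scalerA mulrC -scalerA; congr (_ *: _).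
rewrite mulmx_sumr scaler_sumr.
pose t k := z ^+ i *: (z ^- (i * k) *: G ^+ k).
have tS k : G *m (z ^- (i * k) *: G ^+ k) = t k.+1.
  rewrite /t -scalemxAr -[G *m _]/(G * G ^+ k) -exprS scalerA; congr (_ *: _).
  by rewrite mulnS exprD invfM mulrA divff ?mul1r // expf_neq0.
under eq_bigr do rewrite tS.
have tn : t n = t 0 by rewrite /t Gn muln0 mulnC exprM (prim_expr_order prim_z) expr1n.
have E : \sum_(k < n.+1) t k = \sum_(k < n) t k + t n by rewrite big_ord_recr.
by move: E; rewrite big_ord_recl /= tn addrC => /addIr.
Qed.

Lemma sum_spectral_idem : \sum_(i < n) e i = 1%:M.
Proof.
rewrite -scaler_sumr exchange_big /=.
have E (k : 'I_n) : \sum_(i < n) z ^- (i * k) *: G ^+ k =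
    (if k == 0 :> nat then n%:R else 0) *: G ^+ k.
  rewrite -scaler_suml; congr (_ *: _).
  under eq_bigr do rewrite mulnC exprM -exprVn.
  have [->|k0] := eqVneq (k : nat) 0%N.
    by under eq_bigr do rewrite expr0 invr1 expr1n; rewrite sumr_const card_ord.
  rewrite sum_expr_unity //.
    by rewrite exprVn -exprM mulnC exprM (prim_expr_order prim_z) expr1n invr1.
  by rewrite invr_eq1 -(prim_order_dvd prim_z) gtnNdvd ?lt0n.
under eq_bigr do rewrite E.
rewrite (bigD1 (Ordinal n_gt0)) //= big1 => [|k]; last first.
  by rewrite -(inj_eq val_inj) /= => /negPf->; rewrite scale0r.
by rewrite addr0 scalerA mulVf // scale1r.
Qed.

Lemma spectral_idemM (i j : 'I_n) : e i *m e j = if i == j then e i else 0.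
Proof.
have GX k : G ^+ k *m e j = z ^+ (j * k) *: e j.
  elim: k => [|k IHk]; first by rewrite mul1mx muln0 scale1r.
  rewrite exprSr -[_ * G]/(_ *m G) -mulmxA mul_spectral_idem -scalemxAr IHk scalerA.
  by rewrite mulnS exprD.
rewrite {1}/spectral_idem -scalemxAl mulmx_suml.
under eq_bigr do rewrite -scalemxAl GX scalerA !exprM -exprVn -exprMn.
rewrite -scaler_suml scalerA; have [-> | ij] := eqVneq i j.
  rewrite mulVf ?expf_neq0 //; under eq_bigr do rewrite expr1n.
  by rewrite sumr_const card_ord mulVf // scale1r.
rewrite sum_expr_unity ?mulr0 ?scale0r //.
  by rewrite exprMn exprVn -!exprM ![(_ * n)%N]mulnC !exprM (prim_expr_order prim_z) !expr1n invr1 mulr1.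
apply: contra ij => /eqP E; rewrite -(inj_eq val_inj) eq_sym.
have := eq_prim_root_expr prim_z j i; rewrite !modn_small // => <-.
by rewrite -[X in _ == X]mulr1 -E mulrA divff ?mul1r // expf_neq0.
Qed.

(** The eigenvalues are split off one at a time: by orthogonality the matrix is a product of factors
    [1 + (z ^+ i - 1) e i], each computed from the rank factorization of [e i] and Sylvester's
    identity. For all [i] together it is [G]. *)
Lemma det_sum_spectral_idem (s : seq 'I_n) : uniq s ->
  \det (1%:M + \sum_(i <- s) (z ^+ i - 1) *: e i) = \prod_(i <- s) (z ^+ i) ^+ \rank (e i).
Proof.
elim: s => [|i s IHs]; first by rewrite !big_nil addr0 det1.
case/andP => is_s uniq_s; rewrite !big_cons -IHs //; set S := \sum_(j <- s) _.
have eS : e i *m S = 0.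
  rewrite mulmx_sumr big_seq big1 // => j js; rewrite -scalemxAr spectral_idemM.
  by case: eqP => [ij|_]; [rewrite ij js in is_s | rewrite scaler0].
have -> : 1%:M + ((z ^+ i - 1) *: e i + S) = (1%:M + (z ^+ i - 1) *: e i) *m (1%:M + S).
  rewrite mulmxDl mul1mx mulmxDr mulmx1 -scalemxAl eS scaler0 addr0.
  by rewrite -addrA [S + _]addrC.
rewrite det_mulmx; congr (_ * _).
have ee : e i *m e i = e i by rewrite spectral_idemM eqxx.
rewrite -[X in _ *: X](mulmx_base (e i)) scalemxAl det_1_mulmxC -scalemxAr row_base_idem //.
by rewrite scalemx1 -raddfD /= addrC subrK det_scalar.
Qed.

Lemma det_spectral : \det G = \prod_(i < n) (z ^+ i) ^+ \rank (e i).
Proof.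
rewrite -big_enum -det_sum_spectral_idem ?enum_uniq //; congr (\det _).
rewrite big_enum /= -[LHS]mulmx1 -sum_spectral_idem mulmx_sumr -big_split /=.
by apply: eq_bigr => i _; rewrite mul_spectral_idem scalerBl scale1r addrC subrK.
Qed.

End SpectralIdempotents.

Lemma det_exp (R : comPzRingType) n (A : 'M[R]_n) k : \det (A ^+ k) = \det A ^+ k.
Proof. by elim: k => [|k IHk]; rewrite ?det1 // !exprS det_mulmx IHk. Qed.

Lemma map_mx_exp (aR rR : comPzRingType) (f : {rmorphism aR -> rR}) n (A : 'M[aR]_n) k :
  map_mx f (A ^+ k) = map_mx f A ^+ k.
Proof. by elim: k => [|k IHk]; rewrite ?map_mx1 // !exprS map_mxM IHk. Qed.

Lemma expf_cardX (F : finFieldType) (x : F) m : x ^+ (#|F| ^ m) = x.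
Proof. by elim: m => [|m IHm]; rewrite ?expr1 // expnS exprM expf_card. Qed.

Lemma finite_expr_period (R : finPzRingType) (x : R) q :
  exists m r, (0 < r)%N /\ x ^+ (q ^ m) ^+ (q ^ r) = x ^+ (q ^ m).
Proof.
have [i [j [lt_ij _ Eij]]] := nat_collision (fun i => x ^+ (q ^ i)).
by exists i, (j - i)%N; rewrite subn_gt0 -exprM -expnD subnKC // ltnW.
Qed.

Section DimTrivial.

Variables (F : finFieldType) (Q : quiver) (T : comPzRingType).
Variable tau : vertex Q -> F -> T.
Hypothesis tauM : forall v, {morph tau v : x y / x * y}.
Hypothesis tau1 : forall v, tau v 1 = 1.
Variables (L : closedFieldType) (incl : {rmorphism F -> L}).

(* A power [g] of [f] with the same determinants is semisimple with eigenvalues powers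
   of [z]. Its eigenspaces are direct summands of [X]; the eigenvalues whose eigenspaces
   have a given dimension vector are permuted by the Frobenius map, so their product is
   in [F]. *)
Lemma dim_aut_trivial (b : dimvec Q) (X : rep F b) :
    (forall (c : dimvec Q) (Y : rep L c), rep_retract (rep_map incl X) Y ->
       dim_trivial tau c) ->
  aut_trivial tau X.
Proof.
move=> dimX f f' hf ff'; pose q := #|F|.
have [N [R [R_gt0 per]]] := finite_expr_period (rep_end_of hf) q.
pose g := rep_end_of hf ^+ (q ^ N).
have gE v : g v = f v ^+ (q ^ N).
  by rewrite -[g v]/(rep_end_at v g) rmorphXn /= /rep_end_at rep_end_ofE.
have det_g v : \det (g v) = \det (f v) by rewrite gE det_exp expf_cardX.
have det_n0 v : \det (g v) != 0.
  rewrite det_g; apply: contraTneq (oner_neq0 F) => d0.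
  by rewrite -(det1 F (b v)) -(ff' v) det_mulmx d0 mul0r eqxx.
have [z prim_z] := Frobenius_prim_root incl R_gt0.
set n := (#|F| ^ R).-1 in prim_z; have n_gt0 := prim_order_gt0 prim_z.
have Dn : n.+1 = (q ^ R)%N.
  by rewrite prednK // expn_gt0 ltnW // card_finField_gt1.
have n_unit : n%:R != 0 :> L.
  apply/negP => /eqP n0; have /eqP := oner_neq0 L; apply.
  rewrite -[LHS]add0r -n0 -mulrSr Dn natrX /q (card_finField_L0 incl) expr0n.
  by rewrite eqn0Ngt R_gt0.
pose G v := map_mx incl (g v).
(* Invertibility turns [g ^+ (q ^ R) = g] into [g v ^+ n = 1]. *)
have Gn v : G v ^+ n = 1.
  have unit_g : g v \in unitmx by rewrite unitmxE unitfE.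
  rewrite -map_mx_exp -[RHS](map_mx1 incl (b v)); congr (map_mx _ _).
  rewrite -[LHS](mulKmx unit_g) -[_ *m _ ^+ _]/(_ * _ ^+ _) -exprS Dn.
  by rewrite -[g v ^+ _]/(rep_end_at v g ^+ _) -rmorphXn per mulVmx.
have hG : rep_hom (rep_map incl X) (rep_map incl X) G.
  by move=> a; rewrite !ffunE -!map_mxM rep_end_hom.
pose e i v := spectral_idem n z (G v) i.
have hGX k : rep_hom (rep_map incl X) (rep_map incl X) (fun v => G v ^+ k).
  elim: k => [|k IHk] a; first by rewrite mulmx1 mul1mx.
  by rewrite !exprS mulmxA hG -mulmxA IHk mulmxA.
have he i : rep_hom (rep_map incl X) (rep_map incl X) (e i).
  move=> a; rewrite -scalemxAr -scalemxAl; congr (_ *: _).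
  rewrite mulmx_sumr mulmx_suml; apply: eq_bigr => k _.
  by rewrite -scalemxAr -scalemxAl hGX.
have ee (i : 'I_n) v : e i v *m e i v = e i v.
  by rewrite (spectral_idemM prim_z n_unit (Gn v)) eqxx.
have dim_e (i : 'I_n) : dim_trivial tau (fun v => \rank (e i v)).
  by have [Y [A [B [hA hB BA _]]]] := rep_idem_retract (he i) (ee i); apply: (dimX _ Y); exists A, B.
(* The Frobenius map sends [z ^+ i] to [z ^+ (i * q)], so it acts on the indices as multiplication
   by [q] modulo [n]. *)
pose pi (i : 'I_n) : 'I_n := Ordinal (ltn_pmod (i * q) n_gt0).
have zpi i : z ^+ pi i = Frobenius incl (z ^+ i).
  by rewrite /Frobenius -exprM prim_expr_mod.
have pi_inj : injective pi.
  move=> i j /(congr1 (fun k : 'I_n => z ^+ k)); rewrite !zpi => /fmorph_inj/eqP.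
  by rewrite (eq_prim_root_expr prim_z) !modn_small // => /eqP/val_inj.
have frobG v : map_mx (Frobenius incl) (G v) = G v.
  by apply/matrixP => x y; rewrite !mxE Frobenius_incl.
have e_pi i v : e (pi i) v = map_mx (Frobenius incl) (e i v).
  rewrite /e /spectral_idem map_mxZ fmorphV rmorph_nat; congr (_ *: _).
  rewrite (map_mx_sum (Frobenius incl)); apply: eq_bigr => k _.
  by rewrite map_mxZ map_mx_exp frobG !exprM fmorphV rmorphXn zpi.
(* Dimension vectors bounded by [b] form a finite type, by which the eigenvalues can be
   partitioned. *)
pose key (i : 'I_n) : {dffun forall v : vertex Q, 'I_(b v).+1} :=
  [ffun v : vertex Q => Ordinal (rank_leq_row (e i v) : (_ < (b v).+1)%N)].
have key_pi i : key (pi i) = key i.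
  by apply/ffunP => v; rewrite !ffunE; apply: val_inj; rewrite /= e_pi mxrank_map.
pose x c := \prod_(i | key i == c) z ^+ i.
have [y Dy] : exists y : _ -> F, forall c, x c = incl (y c).
  suff xq c : {a | x c == incl a} by exists (fun c => sval (xq c)) => c; apply/eqP/(svalP (xq c)).
  apply: sigW; have [|a ->] := @Frobenius_fixed F L incl (x c); last by exists a.
  rewrite -[LHS]/(Frobenius incl (x c)) rmorph_prod /x [RHS](reindex_inj pi_inj) /=.
  by apply: eq_big => i; rewrite ?key_pi ?zpi.
have det_gE v : \det (g v) = \prod_c y c ^+ c v.
  apply: (fmorph_inj incl); rewrite -det_map_mx (det_spectral prim_z n_unit (Gn v)).
  rewrite (partition_big key predT) //= rmorph_prod; apply: eq_bigr => c _.
  rewrite rmorphXn /= -Dy /x -prodrXl; apply: eq_bigr => i /eqP <-.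
  by rewrite ffunE.
under eq_bigr do rewrite -det_g det_gE.
have tau_prod v (I : finType) (h : I -> F) : tau v (\prod_i h i) = \prod_i tau v (h i).
  by apply: (big_morph (tau v)).
under eq_bigr do rewrite tau_prod.
rewrite exchange_big /= big1 // => c _.
have [/existsP[i /eqP ci]|no_i] := boolP [exists i, key i == c]; last first.
  have -> : y c = 1.
    apply: (fmorph_inj incl); rewrite -Dy rmorph1 /x big_pred0 // => i.
    by apply/negbTE; apply: contra no_i => ci; apply/existsP; exists i.
  by rewrite big1 // => v _; rewrite expr1n tau1.
have y0 : y c != 0.
  rewrite -(fmorph_eq0 incl) -Dy prodf_seq_neq0; apply/allP => j _; apply/implyP => _.
  rewrite expf_neq0 //; apply: contra_eq_neq (prim_expr_order prim_z) => ->.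
  by rewrite expr0n (gtn_eqF n_gt0) eq_sym oner_eq0.
rewrite -[RHS](dim_e i _ y0); apply: eq_bigr => v _.
by rewrite (tauX tauM tau1) -ci ffunE.
Qed.

End DimTrivial.

(** * Star-shaped quivers *)

(** The two previous results speak of arbitrary summands over the closure; a summand on which some
    [x] acts nontrivially contains an indecomposable one with this property. *)
Lemma aut_trivialP (F : finFieldType) (Q : quiver) (T : comPzRingType)
    (tau : vertex Q -> F -> T) (tauM : forall v, {morph tau v : x y / x * y})
    (tau1 : forall v, tau v 1 = 1) (b : dimvec Q) (X : rep F b) :
  aut_trivial tau X <->
  (forall c, indec_dims (rep_closure X) c -> dim_trivial tau c).
Proof.
have int_cl : integralRange (to_closure F).
  exact: svalP (projT2 (countable_algebraic_closure F)).
split=> [trX c /indec_dimsP[Y [_ XY]] | dimX].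
  exact: (aut_trivial_dim tauM tau1 int_cl trX XY).
apply: (dim_aut_trivial tauM tau1 (incl := to_closure F)) => c Y XY x x0.
apply: contrapT => nc.
pose p (c : dimvec Q) := \prod_v tau v x ^+ c v <> 1.
have [c0 pc0 c0z|c1 c2 pc|d [Z [indZ YZ pd]]] := indecomposable_retract (p := p) _ _ Y nc.
- by apply: pc0; rewrite big1 // => v _; rewrite c0z expr0.
- apply: contrapT => /not_orP[/contrapT p1 /contrapT p2]; apply: pc.
  under eq_bigr do rewrite exprD.
  by rewrite big_split /= p1 p2 mulr1.
apply: pd; apply: dimX => //; apply/indec_dimsP; exists Z; split=> //.
exact: rep_retract_trans XY YZ.
Qed.

(* Recursion along the arrows [S] of a forest, where each vertex is the target of at most
   one arrow; [rk] measures the distance to the end. *)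
Lemma forest_family (V : eqType) (A : finType) (src tgt : A -> V) (rk : V -> nat)
    (D : V -> Type) (P : forall v, D v -> Prop)
    (Rel : forall a, D (src a) -> D (tgt a) -> Prop) (S : {set A})
    (x0 : forall v, D v) :
    (forall v, P v (x0 v)) ->
    (forall a, a \in S -> (rk (tgt a) < rk (src a))%N) ->
    {in S &, injective tgt} ->
    (forall a, a \in S -> forall x, P _ x -> exists2 y, P _ y & Rel a x y) ->
  exists x : forall v, D v,
    [/\ forall v, P v (x v), forall a, a \in S -> Rel a (x (src a)) (x (tgt a)) &
        forall v, (forall a, a \in S -> tgt a <> v) -> x v = x0 v].
Proof.
move=> Px0; have [m] := ubnP #|S|; elim: m S => // m IHm S le_m rkS injS RelS.
have [->|[a0 a0S]] := set_0Vmem S.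
  by exists x0; split=> // a; rewrite inE.
(* No arrow of [S] starts at the target of [a], so the value there can be reset last without
   disturbing the other relations. *)
have [a aS min_a] := @arg_minnP _ a0 (fun a => a \in S) (fun a => rk (tgt a)) a0S.
have subS b : b \in S :\ a -> b \in S by case/setD1P.
have [||||x [Px Rx x_x0]] := IHm (S :\ a).
- by rewrite -ltnS; apply: leq_trans le_m; rewrite ltnS [X in (_ < X)%N](cardsD1 a) aS.
- by move=> b /subS; apply: rkS.
- by move=> b c /subS bS /subS cS; apply: injS.
- by move=> b /subS; apply: RelS.
have [y Py Rxy] := RelS a aS (x (src a)) (Px _).
have src_neq b : b \in S -> tgt a != src b.
  move=> bS; apply: contraTneq (rkS _ bS) => <-.
  by rewrite -leqNgt min_a.
exists (dfwith x y); split=> [v|b bS|v nv].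
- by case: dfwithP.
- rewrite [dfwith x y (src b)]dfwith_out ?src_neq //.
  have [->|nba] := eqVneq b a; first by rewrite dfwith_in.
  have bS' : b \in S :\ a by rewrite !inE nba.
  rewrite dfwith_out; first exact: Rx.
  by apply: contra nba => /eqP/injS-> //.
- rewrite dfwith_out; last by apply/eqP/nv.
  by apply: x_x0 => b /subS; apply: nv.
Qed.

Section StarCombinatorics.

Variables (k g : nat) (s : 'I_k -> nat).
Local Notation Q := (star g s).
Implicit Types (v : vertex Q) (u : {i : 'I_k & 'I_(s i)}).

Definition depth v : nat := if v is Some u then (tagged u).+1 else 0.

Definition in_leg (i : 'I_k) v : bool := if v is Some u then tag u == i else false.

Definition leg_arrow u : arrow Q := inr u.

Lemma source_leg u : source (leg_arrow u) = Some u.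
Proof. by rewrite /= /star_node liftK; case: u. Qed.

Lemma target_leg u : target (leg_arrow u) = None /\ tagged u = 0 :> nat \/
  exists w, [/\ target (leg_arrow u) = Some w, tag w = tag u & (tagged w).+1 = tagged u :> nat].
Proof.
case: u => i j; rewrite /= /star_node; case: unliftP => [j' e|e]; last first.
  by left; split=> //; have := congr1 val e.
by right; exists (Tagged (fun i => 'I_(s i)) j'); split=> //; have := congr1 val e.
Qed.

Lemma depth_source u : depth (source (leg_arrow u)) = (tagged u).+1.
Proof. by rewrite source_leg. Qed.

Lemma depth_target u : depth (target (leg_arrow u)) = tagged u.
Proof. by case: (target_leg u) => [[-> ->]|[w [-> _ <-]]]. Qed.

Lemma in_leg_source i u : in_leg i (source (leg_arrow u)) = (tag u == i).
Proof. by rewrite source_leg. Qed.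

Lemma in_leg_target i u : in_leg i (target (leg_arrow u)) = (tag u == i) && (0 < tagged u)%N.
Proof.
case: (target_leg u) => [[-> ->]|[w [-> e e']]]; first by rewrite andbF.
by rewrite /= -e' andbT; congr (_ == i).
Qed.

Lemma leg_index_inj u u' : tag u = tag u' -> tagged u = tagged u' :> nat -> u = u'.
Proof.
case: u u' => i j [i' j'] /= e; case: i' / e j' => j' /val_inj ->.
by [].
Qed.

Lemma depth_inj i v v' : in_leg i v -> in_leg i v' -> depth v = depth v' -> v = v'.
Proof.
case: v v' => [u|] [u'|] //= /eqP e /eqP e' [E]; congr Some.
by apply: leg_index_inj; rewrite ?e.
Qed.

Lemma target_leg_inj i u u' : tag u = i -> tag u' = i ->
  target (leg_arrow u) = target (leg_arrow u') -> u = u'.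
Proof.
move=> e e' E; apply: leg_index_inj; rewrite ?e //.
by rewrite -depth_target E depth_target.
Qed.

Lemma leg_arrow_to i v v' : in_leg i v -> in_leg i v' -> (depth v < depth v')%N ->
  exists2 u, tag u = i & target (leg_arrow u) = v.
Proof.
case: v' => // -[i' j] /= iv /eqP e; rewrite e in j * => lt.
have lts : (depth v < s i)%N by apply: leq_trans lt (ltn_ord j).
pose j' : 'I_(s i) := Sub (depth v) lts.
exists (Tagged (fun i => 'I_(s i)) j') => //.
apply: (@depth_inj i) => //; last by rewrite depth_target.
by rewrite in_leg_target eqxx /=; case: (v) iv.
Qed.

End StarCombinatorics.

(** * Kernels along the legs and interval summands *)

Section LegKernel.

Variables (K : fieldType) (k g : nat) (s : 'I_k -> nat).
Local Notation Q := (star g s).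
Variables (b : dimvec Q) (X : rep K b).

Lemma separating_col m p (u : 'rV[K]_m) (M : 'M[K]_(p, m)) :
  ~~ (u <= M)%MS -> exists l : 'cV[K]_m, u *m l = 1%:M /\ M *m l = 0.
Proof.
rewrite submxE; move: (cokermx M) (mulmx_coker M) => N MN /matrix0Pn[i [j]].
rewrite ord1 => c0; exists (((u *m N) 0 j)^-1 *: col j N).
split; rewrite -scalemxAr colE mulmxA; last by rewrite MN mul0mx scaler0.
by rewrite -colE; apply/matrixP => x y; rewrite !ord1 [LHS]mxE [col _ _ _ _]mxE mulVf // mxE.
Qed.

(* [e] is the projector on an interval summand [[v0, vb]] of the leg: [wb] is a vector
   at the deepest vertex [vb] whose image in [v0] is a nonzero element [u] of the kernel. *)
Lemma leg_kernel_idem (u0 : {i : 'I_k & 'I_(s i)}) :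
    ~~ row_free (X (leg_arrow g u0)) ->
  exists e : forall v, 'M[K]_(b v),
    [/\ rep_hom X X e, forall v, e v *m e v = e v, e None = 0 & exists v, e v != 0].
Proof.
set X0 := X _ => nfree; pose i := tag u0; pose v0 : vertex Q := source (leg_arrow g u0).
pose t0 := (tagged u0).+1.
have depth0 : depth v0 = t0 := depth_source g u0.
have leg0 : in_leg i v0 by rewrite in_leg_source eqxx.
pose m0 := b v0.
(* [phi v] is the composite of the maps of the leg from [v] to [v0]. *)
have [||||phi [_ phiX phi_out]] := @forest_family _ _
  (fun u => target (leg_arrow g u)) (fun u => source (leg_arrow g u))
  (fun v => (\max_i s i).+1 - depth v)%N (fun v => 'M[K]_(b v, m0)) (fun v x => True)
  (fun u x y => y = X (leg_arrow g u) *m x)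
  [set u : {i : 'I_k & 'I_(s i)} | (tag u == i) && (t0 <= tagged u)%N]
  (dfwith (fun v => 0) (1%:M : 'M[K]_(b v0, b v0))).
- by [].
- move=> u _; rewrite depth_source depth_target ltn_sub2l //.
  by rewrite ltnS (leq_trans (ltnW (ltn_ord _)) (leq_bigmax (tag u))).
- by move=> u u' _ _; rewrite !source_leg => -[].
- by move=> u _ x _; eexists.
have phi_v0 : phi v0 = 1%:M.
  rewrite phi_out ?dfwith_in // => u; rewrite inE => /andP[_ le] E.
  by have := depth_source g u; rewrite E depth0 => -[] e; rewrite -e ltnn in le.
have phi_0 v : ~~ (in_leg i v && (t0 <= depth v)%N) -> phi v = 0.
  move=> nv; rewrite phi_out.
    rewrite dfwith_out //; apply: contra nv => /eqP <-.
    by rewrite leg0 depth0 leqnn.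
  move=> u; rewrite inE => /andP[iu le] E; case/negP: nv.
  by rewrite -E in_leg_source iu depth_source ltnW.
pose P v := `[< exists w : 'rV[K]_(b v), w *m phi v != 0 /\ w *m phi v *m X0 = 0 >].
have P0 : P v0.
  have /rowV0Pn[w /sub_kermxP wX w0] : kermx X0 != 0 by rewrite kermx_eq0.
  by apply/asboolP; exists w; rewrite phi_v0 mulmx1.
have [vb /asboolP[wb [u0n uX0]] max_vb] := @arg_maxnP _ v0 P (@depth k g s) P0.
set u := wb *m phi vb in u0n uX0.
have rb : in_leg i vb && (t0 <= depth vb)%N.
  by apply: contraNT u0n => /phi_0 E; rewrite /u E mulmx0.
have [legb leb] := andP rb.
(* By maximality of [vb], [u] is not an image of a vector one step further out; [l] separates it
   from all such images. *)
have [l [ul phil]] : exists l : 'cV[K]_m0, u *m l = 1%:M /\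
    forall a, tag a = i -> target (leg_arrow g a) = vb -> phi (source (leg_arrow g a)) *m l = 0.
  have [[a [ia ta]]|na] := pselect (exists a, tag a = i /\ target (leg_arrow g a) = vb).
    have : ~~ (u <= phi (source (leg_arrow g a)))%MS.
      apply/negP => /submxP[w' Du].
      have : P (source (leg_arrow g a)) by apply/asboolP; exists w'; rewrite -Du.
      by move/max_vb; rewrite /= -ta depth_source depth_target ltnn.
    case/separating_col => l [ul pl]; exists l; split=> // a' ia' ta'.
    by rewrite (target_leg_inj (g := g) ia' ia) // ta ta'.
  have : ~~ (u <= (0 : 'M[K]_m0))%MS by rewrite submx0.
  by case/separating_col => l [ul _]; exists l; split=> // a ia ta; case: na; exists a.
(* The vector [wb] is pushed towards [v0] and no further: the arrows used end at depth at least
   [t0]. *)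
have [||||w [_ wX w_out]] := @forest_family _ _
  (fun a => source (leg_arrow g a)) (fun a => target (leg_arrow g a)) (@depth k g s)
  (fun v => 'rV[K]_(b v)) (fun v x => True) (fun a x y => y = x *m X (leg_arrow g a))
  [set a : {i : 'I_k & 'I_(s i)} | [&& tag a == i, t0 <= tagged a & tagged a < depth vb]%N]
  (dfwith (fun v => 0) wb).
- by [].
- by move=> a _; rewrite depth_source depth_target.
- move=> a a'; rewrite !inE => /and3P[/eqP ia _ _] /and3P[/eqP ia' _ _].
  exact: target_leg_inj ia ia'.
- by move=> a _ x _; eexists.
have w_vb : w vb = wb.
  rewrite w_out ?dfwith_in // => a; rewrite inE => /and3P[_ _ lt] E.
  by have := depth_target g a; rewrite E => e; rewrite e ltnn in lt.
have w_0 v : in_leg i v -> (depth vb < depth v)%N -> w v = 0.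
  move=> iv lt; rewrite w_out ?dfwith_out //.
    by apply: contraTneq lt => ->; rewrite ltnn.
  move=> a; rewrite inE => /and3P[_ _ lta] E.
  by move: lt; rewrite -E depth_target ltnNge ltnW.
have w_phi v : in_leg i v -> (t0 <= depth v)%N -> (depth v <= depth vb)%N -> w v *m phi v = u.
  have [m] := ubnP (depth vb - depth v)%N; elim: m v => // m IHm v le_m iv lev.
  rewrite leq_eqVlt => /orP[/eqP e|lt].
    by rewrite (depth_inj iv legb e) w_vb.
  have [a ia ta] := leg_arrow_to iv legb lt.
  have da : depth v = tagged a by rewrite -ta depth_target.
  have aw : a \in [set a : {i : 'I_k & 'I_(s i)} | [&& tag a == i, t0 <= tagged a & tagged a < depth vb]%N].
    by rewrite inE; apply/and3P; split; rewrite -?da //; apply/eqP.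
  have ap : a \in [set a : {i : 'I_k & 'I_(s i)} | (tag a == i) && (t0 <= tagged a)%N].
    by rewrite inE; apply/andP; split; rewrite -?da //; apply/eqP.
  rewrite -ta wX // -mulmxA -phiX //; apply: IHm.
  - rewrite depth_source -da; apply: leq_trans (_ : depth vb - depth v <= m)%N => //.
    by rewrite ltn_sub2l.
  - by rewrite in_leg_source ia.
  - by rewrite depth_source -da (leq_trans lev).
  - by rewrite depth_source -da.
have wv0 : w v0 = u by rewrite -[LHS]mulmx1 -phi_v0 w_phi // depth0.
(* On the interval, a vector is sent to the [l]-coordinate of its image at [v0], times [w v]; it is
   idempotent since [w v *m phi v *m l = u *m l = 1]. *)
pose e v := phi v *m l *m w v.
have e_0 v : ~~ [&& in_leg i v, t0 <= depth v & depth v <= depth vb]%N -> e v = 0.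
  move=> nv; rewrite /e; have [r|/phi_0->] := boolP (in_leg i v && (t0 <= depth v)%N).
    case/andP: r nv => iv lev; rewrite iv lev -ltnNge => lt.
    by rewrite w_0 // mulmx0.
  by rewrite !mul0mx.
(* Inside the interval, commutation is the compatibility of [phi] and [w]; the arrow leaving [v0]
   uses [u *m X0 = 0], and the one entering [vb] uses [phil]. *)
exists e; split=> [a|v||].
- case: a => [a|a].
    by rewrite !e_0 ?mulmx0 ?mul0mx.
  rewrite -/(leg_arrow g a).
  have [ia|nia] := eqVneq (tag a) i; last first.
    by rewrite !e_0 ?mulmx0 ?mul0mx // ?in_leg_source ?in_leg_target (negPf nia).
  have [lt|le] := ltnP (tagged a) t0.
    rewrite [e (target _)]e_0 ?depth_target; last by rewrite [(t0 <= _)%N]leqNgt lt andbF.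
    move: lt; rewrite ltnS leq_eqVlt => /orP[/eqP E|lt].
      have -> : a = u0 by apply: leg_index_inj.
      by rewrite mulmx0 /e -/v0 wv0 -mulmxA uX0 mulmx0.
    by rewrite e_0 ?mulmx0 ?mul0mx // depth_source [(t0 <= _)%N]leqNgt ltnS lt andbF.
  have ap : a \in [set u : {i : 'I_k & 'I_(s i)} | (tag u == i) && (t0 <= tagged u)%N].
    by rewrite inE; apply/andP; split=> //; apply/eqP.
  have [lt|gt|eq] := ltngtP (tagged a) (depth vb).
  + have aw : a \in [set a : {i : 'I_k & 'I_(s i)} |
        [&& tag a == i, t0 <= tagged a & tagged a < depth vb]%N].
      by rewrite inE; apply/and3P; split=> //; apply/eqP.
    by rewrite /e (phiX a ap) (wX a aw) !mulmxA.
  + rewrite !e_0 ?mulmx0 ?mul0mx // ?depth_source ?depth_target.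
      by rewrite [(_ <= depth vb)%N]leqNgt ltnS (ltnW gt) !andbF.
    by rewrite [(_ <= depth vb)%N]leqNgt gt !andbF.
  + have ta : target (leg_arrow g a) = vb.
      apply: (@depth_inj _ _ _ i) => //; last by rewrite depth_target.
      by rewrite in_leg_target (leq_trans _ le) // andbT; apply/eqP.
    rewrite [e (source _)]e_0 ?depth_source; last first.
      by rewrite eq ltnn !andbF.
    by rewrite mul0mx /e !mulmxA -phiX // phil // mul0mx.
- have [r|/e_0->] := boolP [&& in_leg i v, t0 <= depth v & depth v <= depth vb]%N; last first.
    by rewrite mul0mx.
  case/and3P: r => iv lev levb.
  by rewrite /e !mulmxA -(mulmxA _ (w v)) w_phi // -(mulmxA _ u) ul mulmx1.
- by rewrite e_0.
- exists v0; rewrite /e phi_v0 mul1mx; apply: contraNneq u0n => lu0.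
  by rewrite -[u]mul1mx -ul -mulmxA -wv0 lu0 mulmx0.
Qed.

End LegKernel.

Section LevelRowFree.

Variables (F : finFieldType) (k g : nat) (s : 'I_k -> nat).
Local Notation Q := (star g s).
Variables (b : dimvec Q) (X : rep F b).

Definition legs_injective : Prop := forall u, row_free (X (leg_arrow g u)).

(** Injectivity of the legs passes to the summand, because [Y] followed by [B] is the composite of
    the injective maps [B] and [X]. *)
Lemma retract_nonincreasing (L : closedFieldType) (incl : {rmorphism F -> L})
    (c : dimvec Q) (Y : rep L c) :
  legs_injective -> rep_retract (rep_map incl X) Y -> nonincreasing_dims c.
Proof.
move=> freeX [A [B [_ hB BA]]] i j.
pose u : {i : 'I_k & 'I_(s i)} := Tagged (fun i => 'I_(s i)) j.
rewrite -[star_node _]/(source (leg_arrow g u)) -[X in (_ <= c X)%N]/(target (leg_arrow g u)).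
have : row_free (Y (leg_arrow g u) *m B (target (leg_arrow g u))).
  rewrite hB ffunE; apply/row_freeP.
  have /row_freeP[Z XZ] := freeX u.
  exists (map_mx incl Z *m A (source (leg_arrow g u))).
  by rewrite mulmxA -(mulmxA (B _)) -map_mxM XZ map_mx1 mulmx1 BA.
rewrite /row_free => /eqP r.
rewrite -[X in (X <= _)%N]r; apply: leq_trans (mxrankM_maxl _ _) _.
exact: rank_leq_col.
Qed.

(** An indecomposable part of the interval summand vanishes at the centre; being in [V], it is
    nonincreasing along the legs and hence zero. *)
Lemma level_legs_injective (V : set (dimvec Q)) :
  (V `<=` @nonincreasing_dims k g s)%classic -> level_at_most V X -> legs_injective.
Proof.
move=> Vn lev u; apply/negPn/negP => nfree.
have : ~~ row_free (rep_closure X (leg_arrow g u)) by rewrite ffunE row_free_map.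
case/leg_kernel_idem => e [he ee e0 [v0 v0n]].
have [Y [A [B [hA hB BA _]]]] := rep_idem_retract he ee.
pose p (c : dimvec Q) := ~ dim_zero c.
have [|||c [Z [indZ YZ pc]]] := indecomposable_retract (p := p) _ _ Y _.
- by [].
- move=> c1 c2 nz; apply: contrapT => /not_orP[/contrapT z1 /contrapT z2].
  by apply: nz => v; rewrite /dim_add z1 z2.
- by move/(_ v0)/eqP; rewrite mxrank_eq0 (negPf v0n).
apply: pc.
have c0 : c None = 0%N.
  by have := rep_retract_dim (None : vertex Q) YZ; rewrite e0 mxrank0 leqn0 => /eqP.
have Vc : V c.
  apply: lev; apply/indec_dimsP; exists Z; split=> //.
  apply: rep_retract_trans YZ; by exists A, B.
have mono := Vn _ Vc.
suff H m v : depth v = m -> c v = 0%N by move=> v; apply: H.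
elim: m v => [|m IHm] [w|] //= [dw].
have := mono (tag w) (tagged w).
rewrite -[star_node (lift _ _)]/(source (leg_arrow g w)) -[star_node (widen_ord _ _)]/(target (leg_arrow g w)).
rewrite [c (target _)](IHm (target (leg_arrow g w))) ?depth_target // source_leg leqn0.
by move/eqP.
Qed.

End LevelRowFree.

(** * Characters extended to the field, and the level condition *)

Section CharacterExtension.

Variable F : finFieldType.
Implicit Types chi : 'CF([set: {unit F}]).

(** Extension by zero keeps the map multiplicative on all of [F], so that it can be applied directly
    to determinants. *)
Definition char_ext chi (x : F) : algC := chi (insubd (1%g : {unit F}) x) *+ (x != 0).

Lemma char_ext1 chi : chi \is a linear_char -> char_ext chi 1 = 1.
Proof.
move=> lin; rewrite /char_ext oner_neq0 mulr1n -[RHS](lin_char1 lin); congr (chi _).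
by apply: val_inj; rewrite insubdK // unitr1.
Qed.

Lemma char_extM chi : chi \is a linear_char -> {morph char_ext chi : x y / x * y}.
Proof.
move=> lin x y; rewrite /char_ext mulf_eq0 negb_or.
have [->|x0] := eqVneq x 0; first by rewrite mulr0n mul0r.
have [->|y0] := eqVneq y 0; first by rewrite andbF mulr0n mulr0.
rewrite !mulr1n -(lin_charM lin) ?inE //; congr (chi _).
by apply: val_inj; rewrite FinRing.val_unitM !insubdK // ?unitfE ?mulf_neq0.
Qed.

Lemma char_extE chi (x : {unit F}) : char_ext chi (FinRing.uval x) = chi x.
Proof.
rewrite /char_ext -unitfE (valP x) mulr1n; congr (chi _).
by apply: val_inj; rewrite insubdK // (valP x).
Qed.

End CharacterExtension.

Section Level.

Variables (F : finFieldType) (k g : nat) (s : 'I_k -> nat).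
Local Notation Q := (star g s).
Variable gam : forall i : 'I_k, 'I_(s i).+1 -> 'CF([set: {unit F}]).
Hypothesis gam_lin : forall (i : 'I_k) (j : 'I_(s i).+1), gam j \is a linear_char.

Lemma sigma_lin (v : star_vertex s) : sigma gam v \is a linear_char.
Proof.
case: v => [u|] /=; first by rewrite rpredM ?rpredV ?gam_lin.
by apply: rpred_prod => i _; apply: gam_lin.
Qed.

Definition sigma_ext (v : vertex Q) : F -> algC := char_ext (sigma gam v).

Lemma sigma_exp_dim_trivial (c : dimvec Q) :
  sigma_exp gam c = 1 <-> dim_trivial sigma_ext c.
Proof.
have E (x : {unit F}) : sigma_exp gam c x = \prod_(v : vertex Q) sigma_ext v (FinRing.uval x) ^+ c v.
  rewrite prod_cfunE ?inE //; apply: eq_bigr => v _.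
  by rewrite exp_cfunE ?inE // /sigma_ext char_extE.
split=> [c1 x x0 | c1].
  have Dx : x = FinRing.uval (insubd (1%g : {unit F}) x) by rewrite insubdK ?unitfE.
  by rewrite Dx -E c1 cfun1E inE.
apply/cfunP => x; rewrite E cfun1E inE c1 //.
by rewrite -unitfE (valP x).
Qed.

(** The level hypothesis compares [V] with the trivial vectors only between 0 and [b], and the
    dimension vectors of indecomposable summands lie in that range. *)
Lemma level_at_mostP (b : dimvec Q) (V : set (dimvec Q)) (X : rep F b) :
    (V `<=` @nonincreasing_dims k g s)%classic -> of_level gam b V ->
  level_at_most V X <-> legs_injective X /\ aut_trivial sigma_ext X.
Proof.
move=> Vn lev.
have P := aut_trivialP (Q := Q) (tau := sigma_ext) (fun v => char_extM (sigma_lin v)) (fun v => char_ext1 (sigma_lin v)) X.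
have below c : indec_dims (rep_closure X) c -> pos_below b c.
  by case/indec_dimsP => Y [[nz _] XY]; split=> // v; apply: rep_retract_dim XY.
split=> [levX | [freeX /P trX] c indc].
  have freeX := level_legs_injective Vn levX.
  split=> //; apply/P => c indc; apply/sigma_exp_dim_trivial.
  have : (V `&` pos_below b)%classic c by split; [apply: levX | apply: below].
  by rewrite -lev => -[].
suff : (V `&` pos_below b)%classic c by case.
rewrite -lev; split; last by apply/sigma_exp_dim_trivial/trX.
split; last exact: below.
by case/indec_dimsP: indc => Y [_ XY]; apply: retract_nonincreasing XY.
Qed.

End Level.

(** * Flags and parabolic subgroups *)

Section LastRows.

Variables (K : fieldType).

(* The matrix [0 | 1], for [m <= m']. *)
Definition last_rows m m' : 'M[K]_(m, m') := \matrix_(a, b) (b == m' - m + a :> nat)%N%:R.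

Local Notation J := last_rows.

Lemma last_rows_ord m m' (a : 'I_m) : (m <= m')%N -> (m' - m + a < m')%N.
Proof. by move=> le; rewrite -[X in (_ < X)%N](subnK le) ltn_add2l. Qed.

Lemma last_rows_mul m m' p (le : (m <= m')%N) (A : 'M[K]_(m', p)) (a : 'I_m) b :
  (J m m' *m A) a b = A (Ordinal (last_rows_ord a le)) b.
Proof.
rewrite mxE (bigD1 (Ordinal (last_rows_ord a le))) //= big1 => [|c nc].
  by rewrite mxE eqxx mul1r addr0.
by rewrite mxE -[(c == _ :> nat)%N]/(c == Ordinal (last_rows_ord a le)) (negPf nc) mul0r.
Qed.

Lemma mul_last_rowsT m m' p (le : (m <= m')%N) (A : 'M[K]_(p, m')) a (b : 'I_m) :
  (A *m (J m m')^T) a b = A a (Ordinal (last_rows_ord b le)).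
Proof. by rewrite -[A in LHS]trmxK -trmx_mul [LHS]mxE (last_rows_mul le) mxE. Qed.

Lemma last_rows_id m : J m m = 1%:M.
Proof. by apply/matrixP => a b; rewrite !mxE subnn eq_sym. Qed.

Lemma last_rows_comp m1 m2 m3 : (m1 <= m2)%N -> (m2 <= m3)%N -> J m1 m2 *m J m2 m3 = J m1 m3.
Proof.
move=> le12 le23; apply/matrixP => a b; rewrite (last_rows_mul le12) !mxE /=.
by rewrite addnA addnBA // subnK.
Qed.

Lemma last_rowsK m m' : (m <= m')%N -> J m m' *m (J m m')^T = 1%:M.
Proof.
by move=> le; apply/matrixP => a b; rewrite (mul_last_rowsT le) !mxE /= eqn_add2l [in RHS]eq_sym.
Qed.

Lemma last_rowsKl m m' N : (m <= m')%N -> (m' <= N)%N ->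
  J m N *m (J m' N)^T *m J m' N = J m N.
Proof.
move=> le le'; rewrite -[in LHS](last_rows_comp le le') -(mulmxA (J m m')).
by rewrite last_rowsK // mulmx1 last_rows_comp.
Qed.

Lemma last_rows_free m m' : (m <= m')%N -> row_free (J m m').
Proof. by move=> le; apply/row_freeP; exists (J m m')^T; apply: last_rowsK. Qed.

Lemma last_rows_projE m N p (A : 'M[K]_(p, N)) : (m <= N)%N ->
  (forall a (b : 'I_N), (b < N - m)%N -> A a b = 0) ->
  A *m (J m N)^T *m J m N = A.
Proof.
move=> le A0; apply/matrixP => a b; rewrite mxE.
have [lt|ge] := ltnP b (N - m).
  rewrite A0 // big1 // => c _; rewrite [J _ _ _ _]mxE ltn_eqF ?mulr0 //.
  by apply: leq_trans lt (leq_addr _ _).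
have lt : (b - (N - m) < m)%N.
  by rewrite ltn_subLR // subnK.
rewrite (bigD1 (Ordinal lt)) //= big1 => [|c nc].
  rewrite (mul_last_rowsT le) [J _ _ _ _]mxE addr0.
  have -> : Ordinal (last_rows_ord (Ordinal lt) le) = b.
    by apply: val_inj; rewrite /= subnKC.
  by rewrite /= subnKC // eqxx mulr1.
rewrite [J _ _ _ _]mxE; case: eqP => [e|]; last by rewrite mulr0.
by case/eqP: nc; apply: val_inj; rewrite /= e addKn.
Qed.

Lemma complete_last_rows m N (A : 'M[K]_(m, N)) : row_free A ->
  exists2 U : 'M[K]_N, U \in unitmx & J m N *m U = A.
Proof.
move=> freeA; have le : (m <= N)%N by rewrite -(eqP freeA) rank_leq_col.
have E : J m N *m ((J m N)^T *m A) = A by rewrite mulmxA last_rowsK // mul1mx.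
have [|U U1 U2] := @complete_unitmx _ _ _ (J m N) ((J m N)^T *m A).
  by rewrite E (eqP freeA) (eqP (last_rows_free le)).
by exists U => //; rewrite -U2.
Qed.

End LastRows.

Section Blocks.

Variables (F : finFieldType) (n : nat).
Local Notation N := n.+1.

Definition diag_minor (o m : nat) (A : 'M[F]_N) : 'M[F]_m :=
  \matrix_(a, b) A (inord (o + a)) (inord (o + b)).

Lemma det_diag_minorD o m1 m2 (A : 'M[F]_N) :
    (forall (x y : 'I_N), (y < o + m1)%N -> (o + m1 <= x)%N -> A x y = 0) ->
    (o + (m1 + m2) <= N)%N ->
  \det (diag_minor o (m1 + m2) A) =
  \det (diag_minor o m1 A) * \det (diag_minor (o + m1) m2 A).
Proof.
move=> A0 le; rewrite -(@det_ublock _ _ _ (diag_minor o m1 A) (ursubmx (diag_minor o (m1 + m2) A))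
  (diag_minor (o + m1) m2 A)); congr (\det _).
rewrite -[LHS]submxK; congr block_mx; apply/matrixP => a b; rewrite !mxE //=.
  apply: A0; rewrite inordK.
  - by rewrite ltn_add2l.
  - by rewrite (leq_trans _ le) // ltn_add2l (leq_trans (ltn_ord b)) ?leq_addr.
  - by rewrite leq_add2l leq_addr.
  - by rewrite (leq_trans _ le) // ltn_add2l ltn_add2l.
by rewrite !addnA.
Qed.

Lemma diag_minorE m (A : 'M[F]_N) : (m <= N)%N ->
  last_rows F m N *m A *m (last_rows F m N)^T = diag_minor (N - m) m A.
Proof.
move=> le; apply/matrixP => a b; rewrite (mul_last_rowsT le) (last_rows_mul le) mxE.
by congr (A _ _); apply: val_inj; rewrite /= inordK // last_rows_ord.
Qed.

Variable d : seq nat.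
Hypothesis sum_d : sumn d = N.

Lemma sumn_take_leq j l : (j <= l)%N -> (sumn (take j d) <= sumn (take l d))%N.
Proof.
by move=> le; rewrite -(subnKC le) takeD sumn_cat leq_addr.
Qed.

Lemma reshape_index_lt j y : (y < N)%N -> (reshape_index d y < j)%N = (y < sumn (take j d))%N.
Proof.
move=> yN; rewrite -sum_d in yN; have le_y : (sumn (take (reshape_index d y) d) <= y)%N.
  by rewrite -[X in (_ <= X)%N](@reshape_indexK d y) leq_addr.
have lt_y : (y < sumn (take (reshape_index d y).+1 d))%N.
  rewrite (take_nth 0%N) ?reshape_indexP // sumn_rcons.
  by rewrite -[X in (X < _)%N](@reshape_indexK d y) ltn_add2l reshape_offsetP.
apply/idP/idP => lt; first by apply: leq_trans lt_y (sumn_take_leq _).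
by rewrite ltnNge; apply/negP => ge; have := leq_ltn_trans (leq_trans (sumn_take_leq ge) le_y) lt; rewrite ltnn.
Qed.

(** On row vectors, upper block triangular matrices stabilize the spans of the last basis vectors;
    this is why the flags are built from [last_rows]. *)
Lemma ParaP' (h : {'GL_N[F]}) :
  reflect (forall j (x y : 'I_N), (y < sumn (take j d))%N -> (sumn (take j d) <= x)%N -> GLval h x y = 0)
          (h \in Para F N d).
Proof.
apply: (iffP (paraP d h)) => H.
  move=> j x y; rewrite -reshape_index_lt // => lt ge; apply: H; apply: leq_trans lt _.
  by rewrite leqNgt reshape_index_lt // -leqNgt.
move=> x y lt; apply: (H (reshape_index d x)); rewrite -?reshape_index_lt //.
by rewrite leqNgt -reshape_index_lt // ltnn.
Qed.

Lemma det_diag_minor_drop (h : {'GL_N[F]}) j : h \in Para F N d -> (j < size d)%N ->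
  \det (diag_minor (sumn (take j d)) (sumn (drop j d)) h) =
  \det (diag_minor (sumn (take j d)) (nth 0%N d j) h) *
  \det (diag_minor (sumn (take j.+1 d)) (sumn (drop j.+1 d)) h).
Proof.
move=> /ParaP' Ph jd; rewrite [drop j d](drop_nth 0%N) //= (take_nth 0%N) // sumn_rcons.
apply: det_diag_minorD => [x y lt ge|].
  by apply: (Ph j.+1); rewrite (take_nth 0%N) // sumn_rcons.
by rewrite addnA -sumn_rcons -(take_nth 0%N) // -sumn_cat cat_take_drop sum_d.
Qed.

Lemma char_ext_block_det (chi : 'CF([set: {unit F}])) (h : {'GL_N[F]}) j : h \in Para F N d -> (j < size d)%N ->
  \det (diag_minor (sumn (take j d)) (nth 0%N d j) h) != 0 ->
  chi (block_det d j (para_proj d h)) =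
  char_ext chi (\det (diag_minor (sumn (take j d)) (nth 0%N d j) h)).
Proof.
move=> Ph jd det0; rewrite /char_ext det0 mulr1n /block_det; congr (chi (insubd _ _)).
congr (\det _); apply/matrixP => a b; rewrite !mxE para_projE // mxE.
have idx (c : 'I_(nth 0%N d j)) : reshape_index d (inord (flatten_index d j c) : 'I_N) = j.
  by rewrite inordK ?flatten_indexKl // -[X in (_ < X)%N]sum_d flatten_indexP.
by rewrite !idx eqxx.
Qed.

End Blocks.

Lemma sum_tnth_drop m (t : m.-tuple nat) j :
  (\sum_(h < m | j <= h) tnth t h)%N = sumn (drop j t).
Proof.
rewrite sumnE (big_nth 0%N) size_drop size_tuple.
under [RHS]eq_bigr do rewrite nth_drop addnC.
rewrite -{1}[j]add0n -(big_addn 0 m j predT (fun i => nth 0%N t i)) big_geq_mkord.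
by apply: eq_big => [h|h _]; rewrite ?(tnth_nth 0%N).
Qed.

Lemma GLval_unit (F : finFieldType) n (A : 'M[F]_n.+1) : A \in unitmx ->
  exists h : {'GL_n.+1[F]}, GLval h = A.
Proof.
move=> unitA; exists (insubd (1%g : {'GL_n.+1[F]}) A).
by rewrite [LHS]insubdK // unitmxE -unitmxE.
Qed.

(** * Flag configurations as representations with injective legs *)

Section Frames.

Variables (F : finFieldType) (n k g : nat) (s : 'I_k -> nat).
Variable d : forall i : 'I_k, (s i).+1.-tuple nat.
Local Notation N := n.+1.
Local Notation Q := (star g s).
Local Notation alpha := (@star_alpha k g s N d).
Hypothesis sum_d : forall i, sumn (d i) = N.

Lemma alpha_leg i v : in_leg i v -> alpha v = sumn (drop (depth v) (d i)).
Proof. by case: v => // u /= /eqP <-; rewrite sum_tnth_drop. Qed.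

Lemma alpha_le v : (alpha v <= N)%N.
Proof.
case: v => // u; rewrite (@alpha_leg (tag u)) /= ?eqxx // -(sum_d (tag u)).
by rewrite -[X in (_ <= sumn X)%N](cat_take_drop (tagged u).+1) sumn_cat leq_addl.
Qed.

Lemma sub_alpha i v : in_leg i v -> (N - alpha v)%N = sumn (take (depth v) (d i)).
Proof.
move=> iv; rewrite (alpha_leg iv) -(sum_d i) -{1}(cat_take_drop (depth v) (d i)).
by rewrite sumn_cat addnK.
Qed.

Lemma alpha_arrow u : (alpha (source (leg_arrow g u)) <= alpha (target (leg_arrow g u)))%N.
Proof.
case: (target_leg g u) => [[-> _]|[w [-> e e']]]; first exact: alpha_le.
have is_ : in_leg (tag u) (source (leg_arrow g u)) by rewrite in_leg_source.
have iw : in_leg (tag u) (Some w : vertex Q) by rewrite /= e.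
rewrite (alpha_leg is_) (alpha_leg iw) depth_source /= e' -add1n -drop_drop.
by case: (drop (tagged u) _) => //= m l; rewrite drop0 leq_addl.
Qed.

Section Framed.

Variables (Y Y' : rep F alpha) (E E' : forall v, 'M[F]_(alpha v, N)).

(** Compatible embeddings of all the spaces in the central one: a morphism is then determined by its
    component at the centre. *)
Definition framed (Y : rep F alpha) (E : forall v, 'M[F]_(alpha v, N)) : Prop :=
  [/\ forall v, row_free (E v), E None = 1%:M &
      forall u, Y (leg_arrow g u) *m E (target (leg_arrow g u)) = E (source (leg_arrow g u))].

Hypotheses (frY : framed Y E) (frY' : framed Y' E').

Lemma framed_hom f : rep_hom Y Y' f -> forall v, f v *m E' v = E v *m f None.
Proof.
case: frY frY' => _ E0 YE [_ E0' YE'] hf v.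
have [m] := ubnP (depth v); elim: m v => // m IHm [u|] le_m; last by rewrite E0 E0' mulmx1 mul1mx.
rewrite -(source_leg g u) -YE' mulmxA -hf -mulmxA IHm; last by rewrite depth_target.
by rewrite mulmxA YE.
Qed.

Lemma hom_framed (f : forall v, 'M[F]_(alpha v)) :
    (forall l : 'I_g, Y (inl l) *m f None = f None *m Y' (inl l)) ->
    (forall v, f v *m E' v = E v *m f None) -> rep_hom Y Y' f.
Proof.
case: frY frY' => _ _ YE [freeE' _ YE'] hl hE [l|u]; first exact: hl.
rewrite -/(leg_arrow g u); apply: (row_free_inj (freeE' (target (leg_arrow g u)))).
by rewrite -mulmxA hE mulmxA YE -mulmxA YE' hE.
Qed.

End Framed.

Definition star_data : finType := ({ffun 'I_g -> 'M[F]_N} * {ffun 'I_k -> {'GL_N[F]}})%type.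

Definition flag_basis (p : star_data) (v : vertex Q) : {'GL_N[F]} :=
  if v is Some u then p.2 (tag u) else 1%g.

(** With the inverse of the basis, stability under [x] reads [(p.2 i)^-1 * x * p.2 i] in the
    parabolic subgroup, which is the conjugate [x ^ p.2 i] in the formula for induced characters. *)
Definition flag_embedding (p : star_data) (v : vertex Q) : 'M[F]_(alpha v, N) :=
  last_rows F (alpha v) N *m GLval (flag_basis p v)^-1%g.

Definition flag_retraction (p : star_data) (v : vertex Q) : 'M[F]_(N, alpha v) :=
  GLval (flag_basis p v) *m (last_rows F (alpha v) N)^T.

(* The representation of the quiver attached to endomorphisms [p.1] of the central
   space and to the partial flags given by the bases [p.2]. *)
Definition flag_rep (p : star_data) : rep F alpha :=
  [ffun a : arrow Q =>
    match a as a' return 'M[F]_(alpha (@source Q a'), alpha (@target Q a')) with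
    | inl l => p.1 l
    | inr u => flag_embedding p (@source Q (leg_arrow g u)) *m
               flag_retraction p (@target Q (leg_arrow g u))
    end].

Lemma GLvalM (x y : {'GL_N[F]}) : GLval (x * y)%g = GLval x *m GLval y.
Proof. by []. Qed.
Lemma GLvalKV (h : {'GL_N[F]}) : GLval h^-1%g *m GLval h = 1%:M.
Proof. by rewrite -[LHS]/(GLval (h^-1 * h)%g) mulVg. Qed.
Lemma GLvalK (h : {'GL_N[F]}) : GLval h *m GLval h^-1%g = 1%:M.
Proof. by rewrite -[LHS]/(GLval (h * h^-1)%g) mulgV. Qed.

Lemma flag_rep_framed p : framed (flag_rep p) (flag_embedding p).
Proof.
split=> [v||u].
- apply/row_freeP; exists (flag_retraction p v).
  by rewrite mulmxA -(mulmxA (last_rows _ _ _)) GLvalKV mulmx1 last_rowsK ?alpha_le.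
- by rewrite -[LHS]/(last_rows F N N *m GLval (1%g : {'GL_N[F]})^-1%g) invg1 GL_1E mulmx1 last_rows_id.
rewrite ffunE /flag_embedding /flag_retraction -!mulmxA.
have [[-> _]|[w [e1 e2 e3]]] := target_leg g u.
  rewrite -[flag_basis p None]/(1%g : {'GL_N[F]}) invg1 GL_1E -[alpha None]/N.
  by rewrite last_rows_id trmx1 !mulmx1.
have -> : flag_basis p (target (leg_arrow g u)) = flag_basis p (source (leg_arrow g u)).
  by rewrite e1 source_leg /= e2.
rewrite (mulmxA (GLval (flag_basis p (source (leg_arrow g u)))^-1)) GLvalKV mul1mx !mulmxA last_rowsKl ?alpha_le //.
exact: alpha_arrow.
Qed.

End Frames.

Section Transporters.

Variables (F : finFieldType) (n k g : nat) (s : 'I_k -> nat).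
Variable d : forall i : 'I_k, (s i).+1.-tuple nat.
Local Notation N := n.+1.
Local Notation Q := (star g s).
Local Notation alpha := (@star_alpha k g s N d).
Hypothesis sum_d : forall i, sumn (d i) = N.
Local Notation data := (star_data F n k g).
Local Notation rho p := (flag_rep d p).
Local Notation J v := (last_rows F (alpha v) N).
Implicit Types p q r : data.

Definition relative_position p q (x : {'GL_N[F]}) i : {'GL_N[F]} := ((p.2 i)^-1 * x * q.2 i)%g.

Lemma relative_positionM p q r (x y : {'GL_N[F]}) i :
  relative_position p r (x * y)%g i =
    (relative_position p q x i * relative_position q r y i)%g.
Proof. by rewrite /relative_position !mulgA mulgK. Qed.

Definition transporter p q : {set {'GL_N[F]}} :=
  [set x : {'GL_N[F]} | [forall l, p.1 l *m GLval x == GLval x *m q.1 l] &&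
           [forall i, relative_position p q x i \in Para F N (d i)]].

Lemma transporterP p q (x : {'GL_N[F]}) :
  reflect ((forall l, p.1 l *m GLval x = GLval x *m q.1 l) /\
           (forall i, relative_position p q x i \in Para F N (d i)))
          (x \in transporter p q).
Proof.
rewrite inE; apply: (iffP andP) => -[H1 H2]; split.
- by move=> l; apply/eqP/(forallP H1).
- by move=> i; apply: (forallP H2).
- by apply/forallP => l; rewrite H1.
- exact/forallP.
Qed.

Lemma transporterM p q r (x y : {'GL_N[F]}) : x \in transporter p q -> y \in transporter q r ->
  (x * y)%g \in transporter p r.
Proof.
move=> /transporterP[x1 x2] /transporterP[y1 y2]; apply/transporterP; split=> [l|i].
  by rewrite GLvalM mulmxA x1 -!mulmxA y1.
by rewrite (relative_positionM p q) groupM.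
Qed.

Lemma transporterV p q (x : {'GL_N[F]}) : x \in transporter p q -> (x^-1)%g \in transporter q p.
Proof.
move=> /transporterP[x1 x2]; apply/transporterP; split=> [l|i].
  rewrite -[LHS]mul1mx -(GLvalKV x) -!mulmxA; congr (_ *m _).
  by rewrite [in LHS]mulmxA -x1 -mulmxA GLvalK mulmx1.
have -> : relative_position q p x^-1%g i = (relative_position p q x i)^-1%g.
  by rewrite /relative_position !invMg invgK mulgA.
by rewrite groupV.
Qed.

Lemma hom_relative_position p q f (x : {'GL_N[F]}) u :
    rep_hom (rho p) (rho q) f -> f None = GLval x ->
  f (Some u) *m J (Some u : vertex Q) = J (Some u : vertex Q) *m GLval (relative_position p q x (tag u)).
Proof.
move=> hf f0.
have := framed_hom (flag_rep_framed sum_d p) (flag_rep_framed sum_d q) hf (Some u).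
rewrite f0 /flag_embedding -[flag_basis p _]/(p.2 (tag u)) -[flag_basis q _]/(q.2 (tag u)).
move/(congr1 (mulmx^~ (GLval (q.2 (tag u))))).
rewrite -!mulmxA GLvalKV mulmx1 => ->.
by rewrite -!GLvalM !mulgA.
Qed.

Lemma hom_transporter p q f (x : {'GL_N[F]}) :
  rep_hom (rho p) (rho q) f -> f None = GLval x -> x \in transporter p q.
Proof.
move=> hf f0; apply/transporterP; split=> [l|i].
  by have := hf (inl l); rewrite !ffunE f0.
apply/(ParaP' (sum_d i)) => j a b lt ge.
have szd : size (d i) = (s i).+1 by rewrite size_tuple.
(* The condition is empty for [j = 0], and also when [take] returns the whole of [d i]; the other
   indices are the vertices of the leg. *)
case: j lt ge => [|j] lt ge; first by rewrite take0 in lt.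
have [ltj|gej] := ltnP j (s i); last first.
  by rewrite take_oversize ?szd // sum_d leqNgt ltn_ord in ge.
pose u : {i : 'I_k & 'I_(s i)} := Tagged (fun i => 'I_(s i)) (Ordinal ltj).
have iu : in_leg i (Some u : vertex Q) by rewrite /= eqxx.
have le_al := alpha_le sum_d (Some u : vertex Q).
have subu : (N - alpha (Some u : vertex Q))%N = sumn (take j.+1 (d i)) := sub_alpha sum_d iu.
have lta : (a - (N - alpha (Some u : vertex Q)) < alpha (Some u : vertex Q))%N.
  by rewrite ltn_subLR ?subu // -subu subnK.
have -> : a = Ordinal (last_rows_ord (Ordinal lta) le_al).
  by apply: val_inj; rewrite /= subnKC // subu.
have := hom_relative_position u hf f0.
move/matrixP/(_ (Ordinal lta) b); rewrite (last_rows_mul le_al) => <-.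
rewrite mxE big1 // => c _; rewrite [J _ _ _]mxE ltn_eqF ?mulr0 //.
by rewrite subu (leq_trans lt) // leq_addr.
Qed.

Lemma hom_minor p q f (x : {'GL_N[F]}) u :
    rep_hom (rho p) (rho q) f -> f None = GLval x ->
  f (Some u) = diag_minor (sumn (take (tagged u).+1 (d (tag u)))) (alpha (Some u : vertex Q))
                 (GLval (relative_position p q x (tag u))).
Proof.
move=> hf f0; have le_al := alpha_le sum_d (Some u : vertex Q).
have iu : in_leg (tag u) (Some u : vertex Q) by rewrite /= eqxx.
rewrite -(sub_alpha sum_d iu) -(diag_minorE _ le_al) -(hom_relative_position u hf f0).
by rewrite -mulmxA last_rowsK // mulmx1.
Qed.

Definition transporter_hom p q (x : {'GL_N[F]}) v : 'M[F]_(alpha v) :=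
  flag_embedding d p v *m GLval x *m flag_retraction d q v.

Lemma transporter_homE p q (x : {'GL_N[F]}) v : x \in transporter p q ->
  transporter_hom p q x v *m flag_embedding d q v = flag_embedding d p v *m GLval x.
Proof.
move=> /transporterP[_ Px]; rewrite /transporter_hom /flag_embedding /flag_retraction.
set hp := flag_basis p v; set hq := flag_basis q v.
have P : J v *m GLval (hp^-1 * x * hq)%g *m (J v)^T *m J v = J v *m GLval (hp^-1 * x * hq)%g.
  case: v @hp @hq => [u|] hp hq; last first.
    by rewrite -[alpha None]/N last_rows_id trmx1 !mulmx1.
  have iu : in_leg (tag u) (Some u : vertex Q) by rewrite /= eqxx.
  have le_al := alpha_le sum_d (Some u : vertex Q).
  apply: last_rows_projE => // a b lt.
  rewrite (last_rows_mul le_al) (ParaP' (sum_d (tag u)) _ (Px (tag u)) (depth (Some u : vertex Q))) //.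
    by rewrite -(sub_alpha sum_d iu).
  by rewrite -(sub_alpha sum_d iu) /= leq_addr.
transitivity (J v *m GLval (hp^-1 * x * hq)%g *m GLval hq^-1%g).
  by rewrite -P !GLvalM !mulmxA.
by rewrite !GLvalM -!mulmxA GLvalK mulmx1 mulmxA.
Qed.

Lemma transporter_hom0 p q (x : {'GL_N[F]}) : transporter_hom p q x None = GLval x.
Proof.
rewrite /transporter_hom /flag_embedding /flag_retraction.
rewrite -[flag_basis p _]/(1%g : {'GL_N[F]}) -[flag_basis q _]/(1%g : {'GL_N[F]}) invg1 GL_1E.
by rewrite -[alpha None]/N last_rows_id trmx1 !mulmx1 mul1mx.
Qed.

Lemma transporter_hom_hom p q (x : {'GL_N[F]}) : x \in transporter p q ->
  rep_hom (rho p) (rho q) (transporter_hom p q x).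
Proof.
move=> px; have /transporterP[xl _] := px.
apply: (hom_framed (flag_rep_framed sum_d p) (flag_rep_framed sum_d q)) => [l|v].
  by rewrite transporter_hom0 !ffunE; apply: xl.
by rewrite transporter_hom0 transporter_homE.
Qed.

Lemma transporter_homK p q (x : {'GL_N[F]}) v : x \in transporter p q ->
  transporter_hom p q x v *m transporter_hom q p x^-1%g v = 1%:M.
Proof.
move=> px; have [free_p _ _] := flag_rep_framed sum_d p.
apply: (row_free_inj (free_p v)).
rewrite mul1mx -mulmxA (transporter_homE _ (transporterV px)) mulmxA transporter_homE //.
by rewrite -mulmxA GLvalK mulmx1.
Qed.

Lemma flag_rep_isoP p q : rep_iso (rho p) (rho q) <-> exists x, x \in transporter p q.
Proof.
split=> [[f [f' [ff' f'f hf]]] | [x px]].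
  have [|x Dx] := @GLval_unit F n (f None).
    by case: (@mulmx1_unit _ _ (f None) (f' None) (ff' None)).
  by exists x; apply: hom_transporter hf _.
exists (transporter_hom p q x), (transporter_hom q p x^-1%g); split.
- by move=> v; apply: transporter_homK.
- move=> v; rewrite -{2}[x]invgK; apply: transporter_homK.
  exact: transporterV.
- exact: transporter_hom_hom.
Qed.

End Transporters.

Lemma row_freeM (K : fieldType) m n p (A : 'M[K]_(m, n)) (B : 'M[K]_(n, p)) :
  row_free A -> row_free B -> row_free (A *m B).
Proof.
case/row_freeP => A' AA' /row_freeP[B' BB']; apply/row_freeP; exists (B' *m A').
by rewrite mulmxA -(mulmxA A) BB' mulmx1.
Qed.

Section NormalForm.

Variables (F : finFieldType) (n k g : nat) (s : 'I_k -> nat).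
Variable d : forall i : 'I_k, (s i).+1.-tuple nat.
Local Notation N := n.+1.
Local Notation Q := (star g s).
Local Notation alpha := (@star_alpha k g s N d).
Hypothesis sum_d : forall i, sumn (d i) = N.
Local Notation legs := {i : 'I_k & 'I_(s i)}.

Lemma legs_injective_framed (X : rep F alpha) : legs_injective X -> exists E, framed X E.
Proof.
move=> freeX.
have [||||E [freeE RE E0]] := @forest_family _ _
  (fun u : legs => target (leg_arrow g u)) (fun u => source (leg_arrow g u))
  (fun v => (\max_i s i).+1 - depth v)%N (fun v => 'M[F]_(alpha v, N)) (fun v x => row_free x)
  (fun u x y => y = X (leg_arrow g u) *m x) [set: legs]%SET (fun v => last_rows F (alpha v) N).
- by move=> v; apply: last_rows_free; apply: alpha_le.
- move=> u _; rewrite depth_source depth_target ltn_sub2l //.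
  by rewrite ltnS (leq_trans (ltnW (ltn_ord _)) (leq_bigmax (tag u))).
- by move=> u u' _ _; rewrite !source_leg => -[].
- by move=> u _ x free_x; eexists; first exact: row_freeM (freeX u) free_x.
exists E; split=> // [|u]; last by rewrite -RE ?inE.
by rewrite E0 => [|u _]; [apply: last_rows_id | rewrite source_leg].
Qed.

(** Adapted bases are chosen from the far end of each leg inwards, completing at each arrow the
    basis already found. The centre is shared by the legs and keeps the identity; the last
    completion there gives the basis [p.2 i]. *)
Lemma legs_injective_flag_rep (X : rep F alpha) : legs_injective X ->
  exists p : star_data F n k g, rep_iso (flag_rep d p) X.
Proof.
move=> freeX; have [E frE] := legs_injective_framed freeX.
have [freeE E0 XE] := frE.
have [||||f [unit_f Rf f_out]] := @forest_family _ _
  (fun u : legs => source (leg_arrow g u)) (fun u => target (leg_arrow g u))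
  (@depth k g s) (fun v => 'M[F]_(alpha v)) (fun v x => x \in unitmx)
  (fun u x y => last_rows F _ _ *m y = x *m X (leg_arrow g u))
  [set u : legs | (0 < tagged u)%N] (fun v => 1%:M).
- by move=> v; apply: unitmx1.
- by move=> u _; rewrite depth_source depth_target.
- move=> u u'; rewrite !inE => u0 u0' E'.
  apply: (target_leg_inj (i := tag u) (g := g)) => //.
  have := in_leg_target g (tag u) u; rewrite eqxx u0 E' in_leg_target.
  by case/andP => /eqP.
- move=> u _ x unit_x; apply: complete_last_rows.
  by apply: row_freeM; rewrite ?row_free_unit.
have f0 : f None = 1%:M.
  by apply: f_out => u; rewrite inE => u0 /(congr1 (@depth k g s)); rewrite depth_target => e; rewrite e in u0.
have Hex i : exists h : {'GL_N[F]}, forall u : legs, tag u = i -> tagged u = 0 :> nat ->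
    last_rows F (alpha (source (leg_arrow g u))) N *m GLval h^-1%g =
    f (source (leg_arrow g u)) *m E (source (leg_arrow g u)).
  have [[u [ui u0]]|nu] := pselect (exists u : legs, tag u = i /\ tagged u = 0 :> nat); last first.
    (* A leg without vertices: any basis of the central space will do. *)
    by exists 1%g => u ui u0; case: nu; exists u.
  have [|U unitU JU] := @complete_last_rows F _ _ (f (source (leg_arrow g u)) *m E (source (leg_arrow g u))).
    by apply: row_freeM; rewrite ?row_free_unit.
  have [y Dy] := GLval_unit unitU.
  exists y^-1%g => u' u'i u'0.
  have -> : u' = u by apply: leg_index_inj; [rewrite u'i ui | rewrite u'0 u0].
  by rewrite invgK Dy JU.
have [h Hh] := fin_all_exists Hex.
pose p : star_data F n k g := ([ffun l : 'I_g => X (inl l)], [ffun i => h i]).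
have fE v : f v *m E v = flag_embedding d p v.
  have [m] := ubnP (depth v); elim: m v => // m IHm [u|] le_m; last first.
    by have [_ -> _] := flag_rep_framed sum_d p; rewrite f0 E0 mulmx1.
  rewrite -(source_leg g u).
  have [u0|u0] := posnP (tagged u).
    rewrite -(Hh (tag u) u) // /flag_embedding.
    have -> // : flag_basis p (source (leg_arrow g u)) = h (tag u).
    by rewrite source_leg /= ffunE.
  rewrite -XE mulmxA -Rf ?inE // -mulmxA IHm ?depth_target //.
  rewrite /flag_embedding mulmxA last_rows_comp ?alpha_arrow ?alpha_le //.
  have -> // : flag_basis p (target (leg_arrow g u)) = flag_basis p (source (leg_arrow g u)).
  rewrite source_leg.
  have [[_ e]|[w [-> e _]]] := target_leg g u; first by rewrite e in u0.
  by rewrite /= e.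
exists p, f, (fun v => invmx (f v)); split=> [v|v|]; [exact: mulmxV | exact: mulVmx |].
apply: (hom_framed (flag_rep_framed sum_d p) frE) => [l|v].
  by rewrite f0 mulmx1 mul1mx !ffunE.
by rewrite f0 mulmx1.
Qed.

End NormalForm.

(** * The character of the stabilizer of a flag configuration *)

Lemma prod_option (R : comPzSemiRingType) (I : finType) (G : option I -> R) :
  \prod_v G v = G None * \prod_u G (Some u).
Proof.
rewrite (bigD1 None) //=; congr (_ * _).
rewrite (reindex_omap Some id) => [|[u|]] //=.
by apply: eq_bigl => u; rewrite eqxx.
Qed.

Lemma prod_sigT (R : comPzSemiRingType) (I : finType) (T : I -> finType) (G : {i : I & T i} -> R) :
  \prod_u G u = \prod_i \prod_(j : T i) G (Tagged T j).
Proof.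
rewrite (sig_big_dep xpredT (fun _ => xpredT) (fun i j => G (Tagged T j))).
by apply: eq_bigr => -[i j].
Qed.

(** Summation by parts, with [delta j = D j / D j.+1]: regrouping by [D] produces the quotients of
    consecutive characters that define [sigma]. *)
Lemma prod_telescope (A B : fieldType) m (G : 'I_m.+1 -> A -> B) (D delta : nat -> A) :
    (forall j, {morph G j : x y / x * y}) -> (forall j, G j 1 = 1) ->
    (forall j, (j < m.+1)%N -> D j = delta j * D j.+1) -> D m.+1 = 1 ->
    (forall j, D j != 0) ->
  \prod_(j < m.+1) G j (delta j) =
  G ord0 (D 0%N) * \prod_(j < m) (G (lift ord0 j) (D j.+1) *
                               (G (widen_ord (leqnSn m) j) (D j.+1))^-1).
Proof.
move=> GM G1 DS Dm Dn.
have G0 j x : x != 0 -> G j x != 0.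
  move=> x0; apply: contra_neq (oner_neq0 B) => E.
  by rewrite -(G1 j) -(divff x0) GM E mul0r.
have E (j : 'I_m.+1) : G j (delta j) = G j (D j) * (G j (D j.+1))^-1.
  by rewrite (DS j) // GM mulfK ?G0.
under eq_bigr do rewrite E.
rewrite !big_split /= big_ord_recl -mulrA; congr (_ * (_ * _)).
by rewrite big_ord_recr /= Dm G1 invr1 mulr1.
Qed.

Section FlagCharacter.

Variables (F : finFieldType) (n k g : nat) (s : 'I_k -> nat).
Variable d : forall i : 'I_k, (s i).+1.-tuple nat.
Local Notation N := n.+1.
Local Notation Q := (star g s).
Local Notation alpha := (@star_alpha k g s N d).
Hypothesis sum_d : forall i, sumn (d i) = N.
Variable gam : forall i : 'I_k, 'I_(s i).+1 -> 'CF([set: {unit F}]).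
Hypothesis gam_lin : forall (i : 'I_k) (j : 'I_(s i).+1), gam j \is a linear_char.
Local Notation legs := {i : 'I_k & 'I_(s i)}.
Local Notation data := (star_data F n k g).

Lemma sigma_ext_center x : x != 0 ->
  sigma_ext gam (None : vertex Q) x = \prod_i char_ext (gam (ord0 : 'I_(s i).+1)) x.
Proof.
move=> x0; rewrite /sigma_ext /char_ext x0 prod_cfunE ?inE //.
Qed.

Lemma sigma_ext_leg (u : legs) x : x != 0 ->
  sigma_ext gam (Some u : vertex Q) x = char_ext (gam (lift ord0 (tagged u))) x *
     (char_ext (gam (widen_ord (leqnSn (s (tag u))) (tagged u))) x)^-1.
Proof.
move=> x0; rewrite /sigma_ext /char_ext x0 /= !mulr1n cfunE; congr (_ * _).
have lin := gam_lin (widen_ord (leqnSn (s (tag u))) (tagged u)).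
by rewrite invr_lin_char // cfConjCE -lin_charV_conj ?inE // lin_charV ?inE.
Qed.

Definition para_char i (h : {'GL_N[F]}) : algC :=
  \prod_(j < (s i).+1) gam j (block_det (d i) j (para_proj (d i) h)).

Lemma para_charE i (h : {'GL_N[F]}) : h \in Para F N (d i) ->
  para_char i h =
  char_ext (gam (ord0 : 'I_(s i).+1)) (\det (GLval h)) *
  \prod_(j < s i) (char_ext (gam (lift ord0 j))
      (\det (diag_minor (sumn (take j.+1 (d i))) (sumn (drop j.+1 (d i))) h)) *
    (char_ext (gam (widen_ord (leqnSn (s i)) j))
      (\det (diag_minor (sumn (take j.+1 (d i))) (sumn (drop j.+1 (d i))) h)))^-1).
Proof.
move=> Ph; have szd : size (d i) = (s i).+1 by rewrite size_tuple.
(* [D j] is the determinant on the [j]-th step of the flag and [delta j] that on the graded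
   piece. *)
pose D j := \det (diag_minor (sumn (take j (d i))) (sumn (drop j (d i))) h).
pose delta j := \det (diag_minor (sumn (take j (d i))) (nth 0%N (d i) j) h).
have DS j : (j < (s i).+1)%N -> D j = delta j * D j.+1.
  by move=> lt; apply: det_diag_minor_drop; rewrite ?szd.
have Dbig j : ((s i).+1 <= j)%N -> D j = 1.
  by move=> ge; rewrite /D drop_oversize ?szd //= det_mx00.
have D0 : D 0%N = \det (GLval h).
  rewrite /D take0 drop0 /= sum_d; congr (\det _); apply/matrixP => a b.
  by rewrite mxE !add0n !inord_val.
have Dn j : D j != 0.
  have [lt|ge] := ltnP j (s i).+2; last by rewrite Dbig ?oner_neq0 // ltnW.
  elim: j lt => [_|j IHj lt].
    by rewrite D0 -unitfE -unitmxE; apply: (valP h).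
  by have := IHj (ltnW lt); rewrite (DS j lt) mulf_eq0 => /norP[].
have dn j : (j < (s i).+1)%N -> delta j != 0.
  by move=> lt; have := Dn j; rewrite (DS j lt) mulf_eq0 => /norP[].
rewrite -D0 -(@prod_telescope F _ (s i) (fun j => char_ext (gam j)) D delta) //.
- apply: eq_bigr => j _; rewrite (char_ext_block_det (sum_d i)) ?szd //.
  exact: dn.
- by move=> j; apply: char_extM.
- by move=> j; apply: char_ext1.
- exact: Dbig.
Qed.

Definition flag_char (p : data) (x : {'GL_N[F]}) : algC :=
  \prod_i para_char i (relative_position p p x i).

Lemma flag_charE (p : data) f f' (x : {'GL_N[F]}) :
    rep_hom (flag_rep d p) (flag_rep d p) f -> (forall v, f v *m f' v = 1%:M) ->
    f None = GLval x ->
  \prod_v sigma_ext gam v (\det (f v)) = flag_char p x.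
Proof.
move=> hf ff' f0; have /transporterP[_ Px] := hom_transporter sum_d hf f0.
have det0 v : \det (f v) != 0.
  by rewrite -unitfE -unitmxE; case: (mulmx1_unit (ff' v)).
rewrite prod_option sigma_ext_center // prod_sigT -big_split.
apply: eq_bigr => i _; rewrite para_charE //; congr (_ * _).
  congr char_ext; rewrite f0 /relative_position !GLvalM !det_mulmx mulrAC -det_mulmx.
  by rewrite GLvalKV det1 mul1r.
apply: eq_bigr => j _; pose u : legs := Tagged (fun i => 'I_(s i)) j.
have iu : in_leg i (Some u : vertex Q) by rewrite /= eqxx.
have Df : \det (f (Some u)) = \det (diag_minor (sumn (take j.+1 (d i))) (sumn (drop j.+1 (d i)))
    (GLval (relative_position p p x i))).
  by rewrite (hom_minor sum_d u hf f0) (alpha_leg _ _ iu).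
by rewrite -/u sigma_ext_leg // Df.
Qed.

End FlagCharacter.

(** * Counting *)

Section RepIso.

Variables (K : fieldType) (Q : quiver).

Lemma rep_iso_refl (b : dimvec Q) (X : rep K b) : rep_iso X X.
Proof.
exists (fun v => 1%:M), (fun v => 1%:M); split=> [v|v|a]; rewrite ?mulmx1 //.
by rewrite mul1mx.
Qed.

Lemma rep_iso_sym (b c : dimvec Q) (X : rep K b) (Y : rep K c) : rep_iso X Y -> rep_iso Y X.
Proof.
case=> f [f' [ff' f'f hf]]; exists f', f; split=> // a.
rewrite -[LHS]mul1mx -f'f -!mulmxA; congr (_ *m _).
by rewrite mulmxA -hf -mulmxA ff' mulmx1.
Qed.

Lemma rep_iso_trans (b c e : dimvec Q) (X : rep K b) (Y : rep K c) (Z : rep K e) :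
  rep_iso X Y -> rep_iso Y Z -> rep_iso X Z.
Proof.
case=> f [f' [ff' f'f hf]] [h [h' [hh' h'h hh]]].
exists (fun v => f v *m h v), (fun v => h' v *m f' v); split=> [v|v|a].
- by rewrite mulmxA -(mulmxA (f v)) hh' mulmx1.
- by rewrite mulmxA -(mulmxA (h' v)) f'f mulmx1.
- by rewrite mulmxA hf -!mulmxA hh.
Qed.

End RepIso.

Lemma level_at_most_iso (F : finFieldType) (Q : quiver) (b : dimvec Q) (V : set (dimvec Q))
  (X Y : rep F b) : rep_iso X Y -> level_at_most V X -> level_at_most V Y.
Proof.
case=> f [f' [ff' f'f hf]] levX c [e [Z [W [indZ isoY]]]].
apply: levX; exists e, Z, W; split=> //; apply: rep_iso_trans isoY.
exists (fun v => map_mx (to_closure F) (f v)), (fun v => map_mx (to_closure F) (f' v)).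
split=> [v|v|a]; rewrite -?map_mxM ?ff' ?f'f ?map_mx1 //.
by rewrite !ffunE -!map_mxM hf.
Qed.

Section Counting.

Variables (F : finFieldType) (n k g : nat) (s : 'I_k -> nat).
Variable d : forall i : 'I_k, (s i).+1.-tuple nat.
Local Notation N := n.+1.
Local Notation Q := (star g s).
Local Notation alpha := (@star_alpha k g s N d).
Hypothesis sum_d : forall i, sumn (d i) = N.
Variable gam : forall i : 'I_k, 'I_(s i).+1 -> 'CF([set: {unit F}]).
Hypothesis gam_lin : forall (i : 'I_k) (j : 'I_(s i).+1), gam j \is a linear_char.
Local Notation data := (star_data F n k g).
Implicit Types p q r : data.

Lemma aut_trivial_flag_rep p : aut_trivial (sigma_ext gam) (flag_rep d p) <->
  forall x, x \in transporter d p p -> flag_char d gam p x = 1.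
Proof.
split=> [trX x px | tr f f' hf ff'].
  have hx := transporter_hom_hom sum_d px.
  rewrite -(flag_charE sum_d gam_lin hx (fun v => transporter_homK sum_d v px)).
    exact: (trX _ _ hx (fun v => transporter_homK sum_d v px)).
  exact: transporter_hom0.
have [|x Dx] := @GLval_unit F n (f None).
  by case: (@mulmx1_unit _ _ (f None) (f' None) (ff' None)).
rewrite (flag_charE sum_d gam_lin hf ff' (esym Dx)) tr //.
exact (hom_transporter sum_d hf (esym Dx)).
Qed.

Lemma para_charM i : {in Para F N (d i) &, {morph para_char d gam i : x y / (x * y)%g >-> x * y}}.
Proof.
move=> x y Px Py; rewrite /para_char -big_split; apply: eq_bigr => j _ /=.
have LP z : z \in Para F N (d i) -> para_proj (d i) z \in Levi F N (d i).
  by move=> Pz; rewrite -para_proj_im mem_morphim.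
rewrite para_projM // (block_detM (sum_d i)) ?LP // lin_charM ?inE //.
Qed.

Lemma flag_charM p : {in transporter d p p &,
  {morph flag_char d gam p : x y / (x * y)%g >-> x * y}}.
Proof.
move=> x y /transporterP[_ Px] /transporterP[_ Py]; rewrite /flag_char -big_split.
by apply: eq_bigr => i _; rewrite (relative_positionM p p) para_charM.
Qed.

(** Orthogonality: translating by an element of the stabilizer where the character is not 1
    multiplies the sum by that value. *)
Lemma sum_flag_char p : \sum_(x in transporter d p p) flag_char d gam p x =
  if `[< aut_trivial (sigma_ext gam) (flag_rep d p) >] then #|transporter d p p|%:R else 0.
Proof.
case: asboolP => [/aut_trivial_flag_rep tr|ntr].
  by rewrite (eq_bigr (fun => 1)) // sumr_const.
have [x px nx] : exists2 x, x \in transporter d p p & flag_char d gam p x != 1.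
  apply: contrapT => nex; apply: ntr; apply/aut_trivial_flag_rep => x px.
  by apply/eqP/negPn/negP => nx; apply: nex; exists x.
set S := \sum_(_ in _) _.
have E : S = flag_char d gam p x * S.
  rewrite mulr_sumr {1}/S (reindex_inj (mulgI x)) /=; apply: eq_big => y.
    apply/idP/idP => [xy|]; last exact: transporterM.
    by rewrite -[y](mulKg x); apply: transporterM xy; apply: transporterV.
  move=> xy; rewrite flag_charM //.
  by rewrite -[y](mulKg x); apply: transporterM xy; apply: transporterV.
apply/eqP; have := subrr S; rewrite {2}E -{1}[S]mul1r -mulrBl => /eqP.
by rewrite mulf_eq0 subr_eq0 eq_sym (negPf nx).
Qed.

Lemma card_transporter p q x : x \in transporter d p q -> #|transporter d p q| = #|transporter d q q|.
Proof.
move=> px; rewrite -[RHS](card_imset _ (mulgI x)); apply: eq_card => y.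
apply/idP/imsetP => [py | [z qz ->]]; last exact: transporterM px qz.
exists (x^-1 * y)%g; last by rewrite mulKVg.
exact: transporterM (transporterV px) py.
Qed.

(** Count the pairs [(q, x)] by [x]: the endomorphisms of [q] are then determined, and its [i]-th
    basis runs over a left coset of the parabolic subgroup. *)
Lemma sum_card_transporter p :
  (\sum_q #|transporter d p q| = #|'GL_N[F]| * \prod_i #|Para F N (d i)|)%N.
Proof.
under eq_bigr do rewrite -sum1_card big_mkcond.
rewrite exchange_big /= cardsT -sum_nat_const; apply: eq_bigr => x _.
rewrite -big_mkcond sum1_card.
pose a : {ffun 'I_g -> 'M[F]_N} := [ffun l => GLval x^-1%g *m (p.1 l *m GLval x)].
pose C i : {set {'GL_N[F]}} := ((x^-1 * p.2 i)%g *: Para F N (d i))%g.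
transitivity #|finset.setX [set a] [set h : {ffun 'I_k -> {'GL_N[F]}} | h \in family C]|.
  apply: eq_card => -[Y h]; rewrite [RHS]inE /= [_ \in [set _]]inE [_ \in [set _ | _]]inE.
  apply/transporterP/andP => /= -[H1 H2]; split.
  - apply/eqP/ffunP => l; rewrite ffunE H1 mulmxA GLvalKV mul1mx //.
  - apply/familyP => i; rewrite mem_lcoset invMg invgK; exact: H2.
  - by move=> l; rewrite (eqP H1) ffunE mulmxA GLvalK mul1mx.
  - move=> i; have /familyP/(_ i) := H2; rewrite mem_lcoset invMg invgK.
    done.
rewrite cardsX cards1 mul1n cardsE card_family foldrE big_map big_enum /=.
by apply: eq_bigr => i _; rewrite card_lcoset.
Qed.

End Counting.

Lemma LambdaE (F : finFieldType) n g (x : {'GL_n.+1[F]}) :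
  Lambda F n.+1 g x =
  \sum_(Y : {ffun 'I_g -> 'M[F]_n.+1}) ([forall l, Y l *m GLval x == GLval x *m Y l])%:R.
Proof.
rewrite cfunE inE mulr1n /mxtrace [RHS](reindex (@enum_val _ predT)) /=; last first.
  exact: onW_bij (enum_val_bij _).
apply: eq_bigr => a _; rewrite mxE; congr (nat_of_bool _)%:R.
apply/eqP/forallP => [E l|E].
  have : adj x (enum_val a) l = enum_val a l by rewrite E.
  by rewrite ffunE => {1}<-; rewrite -!mulmxA GLvalKV mulmx1.
apply/ffunP => l; rewrite ffunE.
by rewrite -(eqP (E l)) -mulmxA GLvalK mulmx1.
Qed.

(** * The inner product as a number of isomorphism classes *)

Section Main.

Variables (F : finFieldType) (n k g : nat) (s : 'I_k -> nat).
Variable d : forall i : 'I_k, (s i).+1.-tuple nat.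
Local Notation N := n.+1.
Local Notation Q := (star g s).
Local Notation alpha := (@star_alpha k g s N d).
Hypothesis sum_d : forall i, sumn (d i) = N.
Variable gam : forall i : 'I_k, 'I_(s i).+1 -> 'CF([set: {unit F}]).
Hypothesis gam_lin : forall (i : 'I_k) (j : 'I_(s i).+1), gam j \is a linear_char.
Local Notation data := (star_data F n k g).

Lemma HC_indE i (x : {'GL_N[F]}) :
  HC_ind (sum_d i) (gam (i := i)) x = #|Para F N (d i)|%:R^-1 *
    \sum_(y : {'GL_N[F]}) (if (x ^ y)%g \in Para F N (d i) then para_char d gam i (x ^ y)%g else 0).
Proof.
rewrite cfIndE ?finset.subsetT //; congr (_ * _); apply: eq_big => [y|y _]; first by rewrite inE.
case: ifP => [Pxy|/negbT nP]; last by rewrite cfun0.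
have Lz : para_proj (d i) (x ^ y)%g \in Levi F N (d i).
  by rewrite -para_proj_im mem_morphim.
rewrite cfMorphE ?subxx // cfResE ?mem_morphim //; last by rewrite para_proj_im.
by rewrite cfunE Lz mulr1n.
Qed.

Lemma HC_inner_product :
  '[Lambda F N g * \prod_i HC_ind (sum_d i) (gam (i := i)), 1]_('GL_N[F]) =
  (#|'GL_N[F]| * \prod_i #|Para F N (d i)|)%N%:R^-1 *
  \sum_(p : data) \sum_(x in transporter d p p) flag_char d gam p x.
Proof.
rewrite cfdotE natrM invfM -mulrA; congr (_ * _).
under [X in _ = _ * X]eq_bigr do rewrite big_mkcond.
rewrite [X in _ = _ * X]exchange_big /= big_distrr /=.
apply: eq_big => [x|x _]; first by rewrite inE.
rewrite cfun1E inE rmorph1 mulr1 cfunE prod_cfunE ?inE // LambdaE.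
under eq_bigr do rewrite HC_indE.
rewrite big_split /= natr_prod -prodfV mulrCA; congr (_ * _).
(* The product of the sums over conjugators is a sum over families [h]; with the fixed points [Y]
   counted by [Lambda], these are the configurations [(Y, h)]. *)
rewrite bigA_distr_bigA big_distrlr /= pair_bigA /=; apply: eq_bigr => -[Y h] _ /=.
have relE i : relative_position ((Y, h) : data) ((Y, h) : data) x i = (x ^ h i)%g.
  by rewrite conjgE mulgA.
case: transporterP => [[xY xh]|nx].
  have -> : [forall l, Y l *m GLval x == GLval x *m Y l] by apply/forallP => l; apply/eqP/xY.
  by rewrite mul1r; apply: eq_bigr => i _; rewrite -relE xh.
have [/forallP xY|_] := boolP [forall l, Y l *m GLval x == GLval x *m Y l]; last by rewrite mul0r.
have [i nPi] : exists i, (x ^ h i)%g \notin Para F N (d i).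
  apply: contrapT => nex; apply: nx; split=> [l|i]; first exact/eqP/xY.
  by rewrite relE; apply/negPn/negP => nPi; apply: nex; exists i.
by rewrite mul1r (bigD1 i) //= (negPf nPi) mul0r.
Qed.

Lemma flag_rep_legs_injective (p : data) : legs_injective (flag_rep d p).
Proof.
have [freeE _ YE] := flag_rep_framed sum_d p; move=> u.
have := freeE (source (leg_arrow g u)); rewrite -YE => /row_freeP[B EB].
by apply/row_freeP; exists (flag_embedding d p (target (leg_arrow g u)) *m B); rewrite mulmxA.
Qed.

(** When [p] is isomorphic to [p0], the stabilizer of [p] has as many elements as the transporter
    from [p0] to [p]; all other transporters are empty. *)
Lemma sum_card_transporter_iso (p0 : data) :
  (\sum_(p : data | `[< rep_iso (flag_rep d p0) (flag_rep d p) >]) #|transporter d p p| =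
   #|'GL_N[F]| * \prod_i #|Para F N (d i)|)%N.
Proof.
rewrite -(sum_card_transporter d p0).
rewrite [RHS](bigID (fun p : data => `[< rep_iso (flag_rep d p0) (flag_rep d p) >])) /=.
rewrite [X in _ = (_ + X)%N]big1 ?addn0 => [|p nisop].
  apply: eq_bigr => p /asboolP/(flag_rep_isoP sum_d)[x px].
  by rewrite (card_transporter px).
apply/eqP; rewrite cards_eq0; apply: contraNT nisop => /set0Pn[x px].
by apply/asboolP/(flag_rep_isoP sum_d); exists x.
Qed.

Lemma HC_inner_product_nb_isoclasses (V : set (dimvec Q)) :
    (V `<=` @nonincreasing_dims k g s)%classic -> of_level gam alpha V ->
  '[Lambda F N g * \prod_i HC_ind (sum_d i) (gam (i := i)), 1]_('GL_N[F]) =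
  (nb_isoclasses F alpha V)%:R.
Proof.
move=> Vn lev; rewrite HC_inner_product.
set H := (_ * _)%N.
pose E := [set X : rep F alpha | `[< level_at_most V X >]]%SET.
have inE' (p : data) : `[< aut_trivial (sigma_ext gam) (flag_rep d p) >] = (flag_rep d p \in E).
  rewrite [RHS]inE; apply: asbool_equiv_eq.
  have := level_at_mostP gam_lin (flag_rep d p) Vn lev.
  have := flag_rep_legs_injective p.
  by tauto.
under eq_bigr do rewrite sum_flag_char // inE'.
rewrite -big_mkcond -natr_sum.
pose R (X Y : rep F alpha) := `[< rep_iso X Y >].
rewrite (@sum_equivalence_classes _ _ R E (flag_rep d) _ H).
- rewrite natrM mulrC mulfK // Num.Theory.pnatr_eq0 muln_eq0 negb_or -!lt0n cardG_gt0.
  by rewrite prodn_gt0 // => i; apply: cardG_gt0.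
- move=> X Y Z _ _ _; split; first exact/asboolP/rep_iso_refl.
  move/asboolP => XY; apply: asbool_equiv_eq; split; apply: rep_iso_trans => //.
  exact: rep_iso_sym.
move=> Y; rewrite inE => /asboolP levY.
(* Every class in [E] contains a flag representation, because its level forces injective legs. *)
have [p0 isoY] := legs_injective_flag_rep sum_d (level_legs_injective Vn levY).
rewrite /H -(sum_card_transporter_iso p0); apply: eq_bigl => p.
apply/andP/asboolP => [[_ /asboolP isop]|isop].
  exact: rep_iso_trans isop.
have isop' := rep_iso_trans (rep_iso_sym isoY) isop.
split; last exact/asboolP.
by rewrite inE; apply/asboolP; apply: level_at_most_iso levY.
Qed.

End Main.

Theorem theorem4p5p6 (F : finFieldType) (n k g : nat)
    (n_ge1 : (1 <= n)%N) (k_ge1 : (1 <= k)%N)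
    (s : 'I_k -> nat) (d : forall i : 'I_k, (s i).+1.-tuple nat)
    (sum_d : forall i : 'I_k, sumn (d i) = n)
    (gam : forall i : 'I_k, 'I_(s i).+1 -> 'CF([set: {unit F}]))
    (gam_lin : forall (i : 'I_k) (j : 'I_(s i).+1),
       gam i j \is a linear_char)
    (V : set (dimvec (star g s)))
    (V_nonincr : (V `<=` @nonincreasing_dims k g s)%classic)
    (X_level : of_level gam (star_alpha n d) V)
    (M : {poly int})
    (M_count : is_counting_poly (star_alpha n d) V M) :
  '[Lambda F n g * \prod_(i < k) HC_ind (sum_d i) (gam i), 1]_('GL_n[F])
    = (M.[#|F|%:R])%:~R.
Proof.
(* For [n = n'.+1] the matrix size [n.-1.+1] of ['GL_n] reduces to [n]. *)
case: n n_ge1 => // n' _ in d sum_d X_level M_count *.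
rewrite (HC_inner_product_nb_isoclasses sum_d gam_lin V_nonincr X_level).
by rewrite M_count mulrz_nat.
Qed.
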